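(* Let $m[\Phi_0(B)]:=\lim_{L\to\infty}\frac{1}{|\Lambda_L|}\langle \Phi_0^{(\Lambda_L)}(B),O^{(\Lambda_L)}\Phi_0^{(\Lambda_L)}(B)\rangle$ for $B>0$, where the limit is taken along a sequence of $L$ for which the weak$^\ast$-limit of the vector states $\langle \Phi_0^{(\Lambda_L)}(B),(\cdots)\Phi_0^{(\Lambda_L)}(B)\rangle$ on the quasi-local algebra exists. Then the limit $$m_{\rm s}=\lim_{B\searrow 0} m[\Phi_0(B)]=\lim_{B\searrow 0}\lim_{L\to\infty}\frac{1}{|\Lambda_L|}\langle \Phi_0^{(\Lambda_L)}(B),O^{(\Lambda_L)}\Phi_0^{(\Lambda_L)}(B)\rangle$$ exists. Further, $m_{\rm s}$ is equal to the maximum spontaneous magnetization over all infinite-volume ground states (with zero field).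
   Context: Fix $d\ge 1$ and a spin magnitude $S\in\{1/2,1,3/2,\dots\}$. To each $x\in\mathbb{Z}^d$ associate spin-$S$ operators $S_x^{(1)},S_x^{(2)},S_x^{(3)}$ (Hermitian $(2S+1)\times(2S+1)$ matrices acting on $\mathbb{C}^{2S+1}$ at site $x$) with $[S_x^{(1)},S_x^{(2)}]=iS_x^{(3)}$ and cyclic permutations, and $\sum_i (S_x^{(i)})^2=S(S+1)$; write $\mathbf{S}_x\cdot\mathbf{S}_y=\sum_{i}S_x^{(i)}S_y^{(i)}$. For finite $\Gamma\subset\mathbb{Z}^d$ let $\mathfrak{A}_\Gamma=\bigotimes_{x\in\Gamma}M_{2S+1}(\mathbb{C})$ (with the natural embeddings), $\mathfrak{A}_{\rm loc}=\bigcup_{\Gamma\text{ finite}}\mathfrak{A}_\Gamma$, and the quasi-local algebra is the norm completion of $\mathfrak{A}_{\rm loc}$. For a positive integer $L$ let $\Lambda_L=\{-L+1,\dots,L\}^d$ with periodic boundary conditions (nearest-neighbor pairs $\{x,y\}\subset\Lambda_L$, $|x-y|=1$, are understood with respect to this periodicity). Define $H_{0,{\rm p}}^{(\Lambda)}=\sum_{\{x,y\}\subset\Lambda:|x-y|=1}\mathbf{S}_x\cdot\mathbf{S}_y$, the staggered magnetization $O^{(\Lambda)}=\sum_{x\in\Lambda}(-1)^{x^{(1)}+\cdots+x^{(d)}}S_x^{(3)}$, and $H_{\rm p}^{(\Lambda)}(B)=H_{0,{\rm p}}^{(\Lambda)}-BO^{(\Lambda)}$ for $B\in\mathbb{R}$.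 For each $L$ and $B$, $\Phi_0^{(\Lambda_L)}(B)$ is a normalized ground-state vector of $H_{\rm p}^{(\Lambda_L)}(B)$ chosen invariant under translations by $2$ in each lattice direction. A state $\omega$ on the quasi-local algebra is an infinite-volume ground state (for $B=0$) if $\lim_{L\to\infty}\omega(a^\ast[H_{0,{\rm p}}^{(\Lambda_L)},a])\ge 0$ for all $a\in\mathfrak{A}_{\rm loc}$. For such $\omega$ its (maximum) spontaneous magnetization is $\lim_{N\to\infty}\sup_{|\Lambda_L|\ge N}\frac{1}{|\Lambda_L|}\omega(O^{(\Lambda_L)})$. *)

(* Defs.v *)
From HB Require Import structures.
From mathcomp Require Import all_boot all_order all_algebra.
From mathcomp Require Import all_classical all_reals all_analysis.
From mathcomp Require Import complex.

Set Implicit Arguments.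
Unset Strict Implicit.
Unset Printing Implicit Defensive.

Import Order.TTheory GRing.Theory Num.Theory.
Local Open Scope ring_scope.

Section QuantumSpin.

Variable R : realType.
Local Notation C := (R[i]).

(* lattice dimension d, local Hilbert space dimension q = 2S+1 *)
Variables (d q : nat).

(* ----- Lattice boxes.  The index n corresponds to the paper's L = n+1.
   A site of Lambda_{n+1} = {-n, ..., n+1}^d is stored as
   x : 'I_d -> 'I_(2(n+1)); its i-th (integer) coordinate is x_i - n. *)
Definition site (n : nat) := {ffun 'I_d -> 'I_((n.+1).*2)}.

Definition coord (n : nat) (x : site n) (i : 'I_d) : int :=
  (nat_of_ord (x i))%:Z - n%:Z.

Definition vol (n : nat) : nat := ((n.+1).*2) ^ d.

Definition inbox (n : nat) (c : 'I_d -> int) : bool :=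
  [forall i, (- (n%:Z) <= c i) && (c i <= (n%:Z + 1))].

(* the site of Lambda_{n+1} with integer coordinates c (meaningful when inbox n c) *)
Definition pt (n : nat) (c : 'I_d -> int) : site n :=
  [ffun i => inord (absz (c i + n%:Z))].

Definition adj (n : nat) (x y : site n) : bool :=
  (x != y) &&
  [exists i, [forall j, (j != i) ==> (x j == y j)] &&
             ((y i == ordS (x i)) || (x i == ordS (y i)))].

Definition shift2 (n : nat) (i : 'I_d) (x : site n) : site n :=
  [ffun j => if j == i then ordS (ordS (x j)) else x j].

(* ----- Hilbert space: basis indexed by spin configurations on the box. *)
Definition cfg (n : nat) := {ffun site n -> 'I_q}.
Definition dim (n : nat) : nat := #|{: cfg n}|.
Definition op (n : nat) := 'M[C]_(dim n).
Definition vec (n : nat) := 'cV[C]_(dim n).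

Definition mx_of (n : nat) (f : cfg n -> cfg n -> C) : op n :=
  \matrix_(i, j) f (enum_val i) (enum_val j).

Definition adjmx (m p : nat) (A : 'M[C]_(m, p)) : 'M[C]_(p, m) :=
  (map_mx Num.conj A)^T.

(* single-site operator A acting at site x (tensored with identities) *)
Definition onsite (n : nat) (x : site n) (A : 'M[C]_q) : op n :=
  mx_of (fun s t => A (s x) (t x) *
                    ([forall y, (y != x) ==> (s y == t y)] : bool)%:R).

(* natural embedding A_{Lambda_{n+1}} -> A_{Lambda_{n'+1}} (a |-> a (x) 1), for n <= n' *)
Definition restr (n n' : nat) (s : cfg n') : cfg n :=
  [ffun x : site n => s (pt n' (coord x))].

Definition embed_op (n n' : nat) (a : op n) : op n' :=
  mx_of (fun s t => a (enum_rank (restr n s)) (enum_rank (restr n t)) *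
                    ([forall y : site n', inbox n (coord y) || (s y == t y)] : bool)%:R).

Variables (S1 S2 S3 : 'M[C]_q).

(* H_{0,p}^{(Lambda)} = sum over nearest-neighbour pairs {x,y} of S_x . S_y;
   the sum over ordered adjacent pairs counts each pair twice. *)
Definition H0 (n : nat) : op n :=
  2^-1 *: \sum_(x : site n) \sum_(y : site n | adj x y)
     (onsite x S1 *m onsite y S1 + onsite x S2 *m onsite y S2 +
      onsite x S3 *m onsite y S3).

Definition stag (n : nat) : op n :=
  \sum_(x : site n) ((-1 : C) ^ (\sum_i coord x i)) *: onsite x S3.

Definition Hp (n : nat) (B : R) : op n := H0 n - (B%:C)%C *: stag n.

Definition expv (n : nat) (v : vec n) (A : op n) : C :=
  (adjmx v *m A *m v) ord0 ord0.

Definition ground_vec (n : nat) (H : op n) (v : vec n) : Prop :=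
  adjmx v *m v = 1 /\
  exists E : C, H *m v = E *: v /\
    forall (mu : C) (w : vec n), w != 0 -> H *m w = mu *: w -> E <= mu.

Definition trans2_inv (n : nat) (v : vec n) : Prop :=
  forall (i : 'I_d) (s : cfg n),
    v (enum_rank [ffun x => s (shift2 i x)]) ord0 = v (enum_rank s) ord0.

Definition cvgC (u : nat -> C) (l : C) : Prop :=
  forall e : R, 0 < e -> exists N, forall k, (N <= k)%N -> `|u k - l| < (e%:C)%C.

(* A state on the quasi-local algebra, given by its (compatible) restrictions
   to the local algebras A_{Lambda_{n+1}}, n : nat (these boxes exhaust Z^d):
   linear, positive, normalized, compatible with the embeddings. *)
Definition is_state (w : forall n, op n -> C) : Prop :=
  (forall n (c : C) (a b : op n), w n (c *: a + b) = c * w n a + w n b) /\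
  (forall n (a : op n), 0 <= w n (adjmx a *m a)) /\
  (forall n, w n 1 = 1) /\
  (forall n (a : op n), w n.+1 (embed_op n.+1 a) = w n a).

Definition is_ground_state (w : forall n, op n -> C) : Prop :=
  is_state w /\
  forall n0 (a : op n0), exists l : C, 0 <= l /\
    cvgC (fun n => let A := embed_op n a in
                   w n (adjmx A *m (H0 n *m A - A *m H0 n))) l.

Definition spont_mag (w : forall n, op n -> C) : R :=
  limn_sup (fun n => complex.Re (w n (stag n)) / (vol n)%:R).

End QuantumSpin.

(* Main.v *)
(* Proof idea.  Each finite-volume ground state minimizes the energy among all
   states of its box, so the energies per site E_L(B)/|Lambda_L| are concave in B
   with slope given by the magnetization.  A period-2 ground state of a large
   box, restricted to a smaller one, is a trial state there up to a boundary
   error, hence E_L(B)/|Lambda_L| converges to some e(B) along the full sequence;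
   then -m(B) is a supergradient of the concave function e, so m is monotone and
   has a right limit m_s at 0.

   If w is an infinite-volume ground state at B = 0, summing w(a_j^*[H,a_j]) >= 0
   over a_j = |Phi><e_j|, with Phi the ground state of the box at field B, gives
   w(H_0) <= <Phi, H_0 Phi> + (boundary).  Together with
   <Phi, H(B) Phi> <= w(H(B)) this bounds the magnetization of w by that of Phi
   plus O(1/(B L)), hence by m(B') for each B' > B.

   The maximum is attained by an ultrafilter limit of ground states at fields
   B_k -> 0 in boxes L_k -> infinity; being a limit of period-2 states it has the
   same magnetization per site in each box. *)

(* The sequences [Lseq B] attached to different fields are unrelated, and at a fixed field the
   magnetization is not known to converge along all boxes. Two fields are therefore compared only
   through energies per site, which do converge along all boxes. This is why the bound on an
   infinite-volume ground state passes through a difference quotient between two positive fields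
   instead of the magnetization at one of them. Ground vectors are given only as eigenvectors of
   least eigenvalue E. Factoring H - E as K^* K turns this into a positivity that any state can be
   tested against, including the mixed states obtained by restricting a larger box; it also yields
   the stability inequality for commutators. No operator norm is used: positivity and the Casimir
   identity bound energies and magnetizations. Since every box is periodic, passing to a smaller box
   changes the bonds at its boundary, so comparisons of exchange energies carry an error
   proportional to the number of sites in a boundary layer. *)
Require Import Defs.
From HB Require Import structures.
From mathcomp Require Import all_boot all_order all_algebra.
From mathcomp Require Import all_classical all_reals all_analysis.
From mathcomp Require Import complex.
From mathcomp Require Import ring lra zify.
Import Order.TTheory GRing.Theory Num.Theory.
Import numFieldTopology.Exports numFieldNormedType.Exports.
Local Open Scope ring_scope.
Local Open Scope classical_set_scope.

Set Implicit Arguments.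
Unset Strict Implicit.
Unset Printing Implicit Defensive.

(** * Operators supported on a subset of the sites *)

Section Kernels.
Variables (C : comNzRingType) (q : nat).

Definition kern (X : finType) := {ffun X -> 'I_q} -> {ffun X -> 'I_q} -> C.

Definition pull (X Y : finType) (f : X -> Y) (s : {ffun Y -> 'I_q}) :
  {ffun X -> 'I_q} := [ffun x => s (f x)].

Definition eq_off (X Y : finType) (f : X -> Y) (s t : {ffun Y -> 'I_q}) : bool :=
  [forall y, (y \in codom f) || (s y == t y)].

(* The operator [a] acting through the injection [f] and trivially on the other
   sites; both [onsite] and [embed_op] have this form. *)
Definition kemb (X Y : finType) (f : X -> Y) (a : kern X) : kern Y :=
  fun s t => a (pull f s) (pull f t) * (eq_off f s t)%:R.

Definition kmul (X : finType) (a b : kern X) : kern X :=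
  fun s t => \sum_u a s u * b u t.

Definition glue (X Y : finType) (f : X -> Y) (s : {ffun Y -> 'I_q})
    (v : {ffun X -> 'I_q}) : {ffun Y -> 'I_q} :=
  [ffun y => if [pick x | f x == y] is Some x then v x else s y].

Lemma pull_glue (X Y : finType) (f : X -> Y) (s : {ffun Y -> 'I_q}) v :
  injective f -> pull f (glue f s v) = v.
Proof.
move=> fI; apply/ffunP => x; rewrite !ffunE.
case: pickP => [x' /eqP/fI -> //|/(_ x)]; by rewrite eqxx.
Qed.

Lemma glue_pull (X Y : finType) (f : X -> Y) (s u : {ffun Y -> 'I_q}) :
  eq_off f s u -> glue f s (pull f u) = u.
Proof.
move/forallP => su; apply/ffunP => y; rewrite ffunE.
case: pickP => [x /eqP <-|nx]; first by rewrite ffunE.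
by have /orP[/codomP[x E]|/eqP//] := su y; have := nx x; rewrite E eqxx.
Qed.

Lemma eq_off_glue (X Y : finType) (f : X -> Y) (s : {ffun Y -> 'I_q}) v :
  eq_off f s (glue f s v).
Proof.
apply/forallP => y; rewrite ffunE.
case: pickP => [x /eqP <-|_]; by rewrite ?codom_f ?eqxx ?orbT.
Qed.

Lemma eq_off_trans (X Y : finType) (f : X -> Y) (s u t : {ffun Y -> 'I_q}) :
  eq_off f s u -> eq_off f u t = eq_off f s t.
Proof.
move/forallP => su; apply: eq_forallb => y.
by have /orP[->//|/eqP ->] := su y.
Qed.

(** Only intermediate configurations agreeing with [s] off the image of [f] contribute, and
    [glue f s] parametrizes these by configurations on [X]. *)
Lemma kemb_mul (X Y : finType) (f : X -> Y) (a b : kern X) s t :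
  injective f -> kemb f (kmul a b) s t = kmul (kemb f a) (kemb f b) s t.
Proof.
move=> fI; rewrite /kmul (bigID (eq_off f s)) /= [X in _ + X]big1 ?addr0; last first.
  by move=> u /negPf ns; rewrite /kemb ns mulr0 mul0r.
rewrite (reindex_onto (glue f s) (pull f)); last by move=> u; exact: glue_pull.
rewrite /kemb mulr_suml; apply: eq_big => u.
  by rewrite eq_off_glue pull_glue ?eqxx.
by rewrite pull_glue// eq_off_glue mulr1 mulrA (eq_off_trans _ (eq_off_glue _ _ _)).
Qed.

(** This closed form is symmetric in the two factors, so commutation follows by reading it both
    ways. *)
Lemma kemb_mul_disjoint (X X' Y : finType) (f : X -> Y) (g : X' -> Y)
    (a : kern X) (b : kern X') s t :
  (forall x x', f x != g x') ->
  kmul (kemb f a) (kemb g b) s t = a (pull f s) (pull f t) * b (pull g s) (pull g t) *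
    [forall y, [|| y \in codom f, y \in codom g | s y == t y]]%:R.
Proof.
move=> dis.
(* A nonzero summand forces [u] to equal [s] off the image of [f] and [t] off that of [g]; as the
   images are disjoint, one configuration remains. *)
pose u0 : {ffun Y -> 'I_q} := [ffun y => if y \in codom f then t y else s y].
rewrite /kmul (bigD1 u0) //= big1 ?addr0; last first.
  move=> u uu0; rewrite /kemb; case: (boolP (eq_off f s u)) => [su|_]; last first.
    by rewrite mulr0 mul0r.
  case: (boolP (eq_off g u t)) => [ut|_]; last by rewrite !mulr0.
  case/eqP: uu0; apply/ffunP => y; rewrite ffunE.
  case: ifPn => [/codomP[x ->]|fy].
    have /forallP/(_ (f x))/orP[/codomP[x' E]|/eqP//] := ut.
    by have := dis x x'; rewrite E eqxx.
  by have /forallP/(_ y) := su; rewrite (negPf fy) /= => /eqP.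
rewrite /kemb.
have -> : pull f u0 = pull f t.
  by apply/ffunP => x; rewrite !ffunE; case: ifPn => //; rewrite codom_f.
have -> : pull g u0 = pull g s.
  apply/ffunP => x; rewrite !ffunE; case: ifP => // /codomP[x' E].
  by have := dis x' x; rewrite E eqxx.
have -> : eq_off f s u0.
  by apply/forallP => y; rewrite ffunE; case: ifP; rewrite ?eqxx.
rewrite mulr1 mulrA; congr (_ * _%:R); congr nat_of_bool.
apply: eq_forallb => y; rewrite ffunE orbCA; congr (_ || _).
by case: ifP; rewrite ?eqxx.
Qed.

Lemma kemb_commute (X X' Y : finType) (f : X -> Y) (g : X' -> Y)
    (a : kern X) (b : kern X') s t :
  (forall x x', f x != g x') ->
  kmul (kemb f a) (kemb g b) s t = kmul (kemb g b) (kemb f a) s t.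
Proof.
move=> dis; rewrite !kemb_mul_disjoint// => [|x x']; last by rewrite eq_sym.
rewrite [b _ _ * _]mulrC; congr (_ * _%:R); congr nat_of_bool.
by apply: eq_forallb => y; rewrite orbCA.
Qed.

Lemma kemb_one (X Y : finType) (f : X -> Y) s t :
  kemb f (fun u v => (u == v)%:R) s t = (s == t)%:R.
Proof.
rewrite /kemb -natrM mulnb; congr _%:R; congr nat_of_bool.
apply/andP/eqP => [[/eqP fst /forallP st]|->]; last first.
  by split=> //; apply/forallP => y; rewrite eqxx orbT.
apply/ffunP => y; have /orP[/codomP[x ->]|/eqP//] := st y.
by move/ffunP/(_ x): fst; rewrite !ffunE.
Qed.

Lemma pull_comp (X Y Z : finType) (f : X -> Y) (g : Y -> Z) (s : {ffun Z -> 'I_q}) :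
  pull f (pull g s) = pull (g \o f) s.
Proof. by apply/ffunP => x; rewrite !ffunE. Qed.

Lemma kemb_comp (X Y Z : finType) (f : X -> Y) (g : Y -> Z) (a : kern X) s t :
  injective g -> kemb g (kemb f a) s t = kemb (g \o f) a s t.
Proof.
move=> gI; rewrite /kemb !pull_comp -mulrA -natrM mulnb.
congr (_ * _%:R); congr nat_of_bool; apply/andP/forallP => [[/forallP Hf /forallP Hg] z|H].
  have /orP[/codomP[y ->]|->] := Hg z; last by rewrite orbT.
  have := Hf y; rewrite !ffunE => /orP[/codomP[x ->]|->]; last by rewrite orbT.
  by rewrite (codom_f (g \o f)).
split; apply/forallP => y; last first.
  have /orP[/codomP[x /= ->]|->] := H y; last by rewrite orbT.
  by rewrite codom_f.
rewrite !ffunE; have /orP[/codomP[x /= /gI ->]|->] := H (g y); last by rewrite orbT.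
by rewrite codom_f.
Qed.

Lemma kemb_pull (X Y : finType) (f : X -> Y) (g : Y -> Y) (a : kern X) s t :
  bijective g -> kemb f a (pull g s) (pull g t) = kemb (g \o f) a s t.
Proof.
move=> [g' gK g'K]; rewrite -kemb_comp; last exact: can_inj gK.
rewrite [RHS]/kemb (_ : eq_off g s t) ?mulr1//.
by apply/forallP => y; rewrite -(g'K y) codom_f.
Qed.

Lemma pull_bij (X : finType) (g : X -> X) :
  bijective g -> bijective (pull g).
Proof.
move=> [g' gK g'K]; apply: (@Bijective _ _ _ (pull g')) => s; rewrite pull_comp;
  by apply/ffunP => x; rewrite ffunE /= ?gK ?g'K.
Qed.

End Kernels.

(** * Geometry of the boxes *)

Section Sites.
Variable d : nat.
Local Notation coord := Defs.coord.

Definition iota_site (n L : nat) (x : site d n) : site d L := pt L (coord x).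

(** Box [n] stores integer coordinates with offset [n], hence the shift by [L - n]. In this form the
    geometric facts below come down to [lia]. *)
Lemma val_iota n L (x : site d n) i : (n <= L)%N ->
  (iota_site L x i : nat) = (x i + (L - n))%N.
Proof.
move=> nL; rewrite ffunE /Defs.coord.
have -> : (nat_of_ord (x i))%:Z - n%:Z + L%:Z = (x i + (L - n))%N%:Z by lia.
have lt : (x i + (L - n) < (L.+1).*2)%N by have := ltn_ord (x i); lia.
by rewrite absz_nat inordK.
Qed.

Lemma coord_iota n L (x : site d n) i : (n <= L)%N ->
  coord (iota_site L x) i = coord x i.
Proof. by move=> nL; rewrite /Defs.coord val_iota//; lia. Qed.

Lemma iota_inj n L : (n <= L)%N -> injective (@iota_site n L).
Proof.
move=> nL x y E; apply/ffunP => i; apply: val_inj => /=.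
by have := congr1 (fun z : site d L => nat_of_ord (z i)) E; rewrite !val_iota//; lia.
Qed.

Lemma iota_comp n m L (x : site d n) : (n <= m)%N -> (m <= L)%N ->
  iota_site L (iota_site m x) = iota_site L x.
Proof.
move=> nm mL; apply/ffunP => i; apply: val_inj => /=.
by rewrite !val_iota//; lia.
Qed.

Lemma iota_id n (x : site d n) : iota_site n x = x.
Proof. by apply/ffunP => i; apply: val_inj => /=; rewrite val_iota//; lia. Qed.

Lemma inbox_iota n L (x : site d n) : (n <= L)%N -> inbox n (coord (iota_site L x)).
Proof.
move=> nL; apply/forallP => i; rewrite coord_iota// /Defs.coord.
by have := ltn_ord (x i); lia.
Qed.

Lemma inbox_ex n L (y : site d L) : (n <= L)%N -> inbox n (coord y) ->
  exists x : site d n, y = iota_site L x.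
Proof.
move=> nL /forallP yn; exists (pt n (coord y)).
have H (i : 'I_d) : ((pt n (coord y) : site d n) i : nat) = (y i + n - L)%N.
  have yi := yn i; rewrite ffunE; rewrite /Defs.coord in yi *.
  have lt : (absz ((y i : nat)%:Z - L%:Z + n%:Z)%R < (n.+1).*2)%N by lia.
  by rewrite inordK//; lia.
apply/ffunP => i; apply: val_inj => /=; rewrite val_iota// H.
by have := yn i; rewrite /Defs.coord; lia.
Qed.

Lemma inbox_codom n L (y : site d L) : (n <= L)%N ->
  inbox n (coord y) = (y \in codom (@iota_site n L)).
Proof.
move=> nL; apply/idP/codomP => [/inbox_ex|[x ->]]; [exact|exact: inbox_iota].
Qed.

Lemma card_site n : #|{: site d n}| = vol d n.
Proof. by rewrite card_ffun !card_ord. Qed.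

Lemma adj_sym n (x y : site d n) : adj x y = adj y x.
Proof.
rewrite /adj eq_sym; congr (_ && _); apply: eq_existsb => i.
rewrite orbC; congr (_ && _); apply: eq_forallb => j.
by rewrite [x j == _]eq_sym.
Qed.

Lemma adj_neq n (x y : site d n) : adj x y -> x != y.
Proof. by case/andP. Qed.

(** Replaces the modulus in the cyclic successor by a case split, so that [lia] can decide
    adjacency. *)
Lemma ordS_val n (i j : 'I_(n.+1).*2) :
  (j == ordS i) = (j == (if i == (n.+1).*2.-1 :> nat then 0 else i.+1) :> nat).
Proof.
have e : val (ordS i) = (i.+1 %% (n.+1).*2)%N by [].
rewrite -val_eqE e {e}; congr (_ == _).
move: (nat_of_ord i) (ltn_ord i) => k kn.
case: ifPn => [/eqP E|/eqP H]; last by rewrite modn_small//; lia.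
have Ek : k.+1 = (n.+1).*2 by lia.
by rewrite Ek modnn.
Qed.

(** Only an inequality, because in the box of side 2 the forward and backward neighbours along an
    axis coincide. *)
Lemma card_adj n (x : site d n) : (#|[pred y | adj x y]| <= d.*2)%N.
Proof.
pose f (p : 'I_d * bool) : site d n :=
  [ffun j => if j == p.1 then (if p.2 then ordS (x j) else ord_pred (x j)) else x j].
have sub : [pred y | adj x y] \subset codom f.
  apply/fintype.subsetP => y /andP[_ /existsP[i /andP[/forallP H]]] /orP[] /eqP E.
    apply/codomP; exists (i, true); apply/ffunP => j; rewrite ffunE /=.
    by case: eqP => [->//|/eqP ji]; have := H j; rewrite ji => /eqP.
  apply/codomP; exists (i, false); apply/ffunP => j; rewrite ffunE /=.
  case: eqP => [->//|/eqP ji]; last by have := H j; rewrite ji => /eqP.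
  by rewrite E ordSK.
apply: leq_trans (subset_leq_card sub) _; apply: leq_trans (card_size _) _.
by rewrite size_codom card_prod card_ord card_bool muln2.
Qed.

(* Sites of the inner box have no neighbour across the periodic boundary. *)
Lemma adj_iota n m L (x : site d m) (y : site d m) :
  (n < m)%N -> (m <= L)%N -> inbox n (coord x) ->
  adj (iota_site L x) (iota_site L y) = adj x y.
Proof.
move=> nm mL xn; rewrite /adj (inj_eq (@iota_inj _ _ mL)); congr (_ && _).
apply: eq_existsb => i; congr (_ && _).
  apply: eq_forallb => j; congr (_ ==> _).
  by rewrite -!val_eqE /= !val_iota// eqn_add2r.
rewrite !ordS_val !val_iota//.
have /forallP/(_ i) := xn; rewrite /Defs.coord.
move: (nat_of_ord (x i)) (nat_of_ord (y i)) (ltn_ord (x i)) (ltn_ord (y i)) => a b.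
by do 4![case: ifPn => /eqP ?]; lia.
Qed.

Lemma adj_iota_ex n m L (x : site d m) (z : site d L) :
  (n < m)%N -> (m <= L)%N -> inbox n (coord x) ->
  adj (iota_site L x) z -> exists y : site d m, z = iota_site L y.
Proof.
move=> nm mL xn /andP[_ /existsP[i /andP[/forallP H1 H2]]].
apply: inbox_ex => //; apply/forallP => j; rewrite /Defs.coord.
(* Coordinates of neighbours differ by at most one; since [x] lies in the smaller box [n],
   wrap-around is excluded. *)
have Hj k : (z k : nat) = (x k + (L - m))%N \/
   (z k : nat) = (x k + (L - m)).+1%N \/ (z k).+1 = (x k + (L - m))%N.
  case: (eqVneq k i) => [->|ki].
    right; move: H2; rewrite !ordS_val !val_iota//.
    have /forallP/(_ i) := xn; rewrite /Defs.coord.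
    move: (nat_of_ord (x i)) (nat_of_ord (z i)) (ltn_ord (x i)) (ltn_ord (z i)) => a b.
    by do 2![case: ifPn => /eqP ?]; lia.
  by left; have := H1 k; rewrite ki /= -val_eqE /= val_iota// => /eqP.
have /forallP/(_ j) := xn; rewrite /Defs.coord.
by have := Hj j; have := ltn_ord (x j); have := ltn_ord (z j); lia.
Qed.

Lemma sum_adj_iota (V : nmodType) n m L (x : site d m) (F : site d L -> V) :
  (n < m)%N -> (m <= L)%N -> inbox n (coord x) ->
  \sum_(z | adj (iota_site L x) z) F z = \sum_(y | adj x y) F (iota_site L y).
Proof.
move=> nm mL xn.
rewrite [RHS](eq_bigl (fun y => adj (iota_site L x) (iota_site L y))); last first.
  by move=> y; rewrite (adj_iota _ nm).
have -> : \sum_(y : site d m | adj (iota_site L x) (iota_site L y)) F (iota_site L y) =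
    \sum_(z in [set iota_site L y | y in [pred y : site d m | adj (iota_site L x) (iota_site L y)]]%SET) F z.
  by rewrite big_imset//=; move=> ? ? _ _; exact: iota_inj.
apply: eq_bigl => z; apply/idP/imsetP => [xz|[y xy ->//]].
have [y zy] := adj_iota_ex nm mL xn xz.
by exists y; rewrite // inE -zy.
Qed.

Lemma sum_site_iota (V : zmodType) n L (F : site d L -> V) : (n <= L)%N ->
  \sum_z F z = \sum_(x : site d n) F (iota_site L x) +
    \sum_(z : site d L | ~~ inbox n (coord z)) F z.
Proof.
move=> nL; rewrite (bigID (fun z : site d L => inbox n (coord z))) /=; congr (_ + _).
have -> : \sum_(x : site d n) F (iota_site L x) =
    \sum_(z in [set iota_site L y | y in {: site d n}]%SET) F z.
  by rewrite big_imset//=; move=> ? ? _ _; exact: iota_inj.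
apply: eq_bigl => z; rewrite inbox_codom//.
by apply/codomP/imsetP => [[y ->]|[y _ ->]]; exists y.
Qed.

Lemma vol_le n L : (n <= L)%N -> (vol d n <= vol d L)%N.
Proof. by move=> nL; rewrite -!card_site; exact: leq_card (iota_inj nL). Qed.

(** The count is kept as a sum of ones so that boundary errors can be compared with it termwise. *)
Lemma card_outside n L : (n <= L)%N ->
  (\sum_(z : site d L | ~~ inbox n (coord z)) 1 = vol d L - vol d n)%N.
Proof.
move=> nL; rewrite -!card_site -(cardC [pred z : site d L | inbox n (coord z)]).
have -> : #|[pred z : site d L | inbox n (coord z)]| = #|{: site d n}|.
  rewrite -(card_codom (@iota_inj _ _ nL)); apply: eq_card => z.
  by rewrite inE inbox_codom.
by rewrite addKn sum1_card.
Qed.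

End Sites.

(** * The operator algebras *)

Section Adjoint.
Variable R : realType.
Local Notation C := R[i].

Lemma adjmxK m p (A : 'M[C]_(m, p)) : adjmx (adjmx A) = A.
Proof. by apply/matrixP => i j; rewrite !mxE conjCK. Qed.

Lemma adjmxM m p k (A : 'M[C]_(m, p)) (B : 'M[C]_(p, k)) :
  adjmx (A *m B) = adjmx B *m adjmx A.
Proof. by rewrite /adjmx map_mxM trmx_mul. Qed.

Lemma adjmxD m p (A B : 'M[C]_(m, p)) : adjmx (A + B) = adjmx A + adjmx B.
Proof. by rewrite /adjmx map_mxD linearD. Qed.

Lemma adjmxN m p (A : 'M[C]_(m, p)) : adjmx (- A) = - adjmx A.
Proof. by rewrite /adjmx map_mxN linearN. Qed.

Lemma adjmxB m p (A B : 'M[C]_(m, p)) : adjmx (A - B) = adjmx A - adjmx B.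
Proof. by rewrite adjmxD adjmxN. Qed.

Lemma adjmxZ m p (c : C) (A : 'M[C]_(m, p)) : adjmx (c *: A) = c^* *: adjmx A.
Proof. by rewrite /adjmx map_mxZ linearZ. Qed.

Lemma adjmx1 m : adjmx (1%:M : 'M[C]_m) = 1%:M.
Proof. by rewrite /adjmx map_mx1 trmx1. Qed.

Lemma adjmx_sum m p (I : finType) (P : pred I) (F : I -> 'M[C]_(m, p)) :
  adjmx (\sum_(i | P i) F i) = \sum_(i | P i) adjmx (F i).
Proof. by apply: (big_morph _ (@adjmxD m p)); apply/matrixP => i j; rewrite !mxE rmorph0. Qed.

End Adjoint.

Section Operators.
Variables (R : realType) (d q : nat).
Local Notation C := R[i].
Local Notation coord := Defs.coord.

(** Indexing entries by configurations instead of ordinals reduces matrix identities to the kernel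
    identities above. *)
Definition kof n (A : op R d q n) : kern C q (site d n) :=
  fun s t => A (enum_rank s) (enum_rank t).

Lemma kofP n (A B : op R d q n) : (forall s t, kof A s t = kof B s t) -> A = B.
Proof.
move=> AB; apply/matrixP => i j.
by have := AB (enum_val i) (enum_val j); rewrite /kof !enum_valK.
Qed.

Lemma kof_mx_of n f s t : kof (mx_of f : op R d q n) s t = f s t.
Proof. by rewrite /kof mxE !enum_rankK. Qed.

Lemma kofM n (A B : op R d q n) s t : kof (A *m B) s t = kmul (kof A) (kof B) s t.
Proof.
rewrite /kof mxE /kmul (reindex enum_rank) //=.
by apply: onW_bij; exact: enum_rank_bij.
Qed.

Lemma kof1 n s t : kof (1%:M : op R d q n) s t = (s == t)%:R.
Proof. by rewrite /kof mxE (inj_eq enum_rank_inj). Qed.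

Lemma kof_embed n L (a : op R d q n) s t : (n <= L)%N ->
  kof (embed_op L a) s t = kemb (@iota_site d n L) (kof a) s t.
Proof.
move=> nL; rewrite kof_mx_of /kof /kemb; congr (_ * _%:R); congr nat_of_bool.
by apply: eq_forallb => y; rewrite inbox_codom.
Qed.

(** A site seen as an injection of [unit], which puts [onsite] in the form [kemb]. *)
Definition one_site n (x : site d n) (_ : unit) : site d n := x.

Lemma kof_onsite n (x : site d n) (A : 'M[C]_q) s t :
  kof (onsite x A) s t = kemb (one_site x) (fun u v => A (u tt) (v tt)) s t.
Proof.
rewrite kof_mx_of /kemb !ffunE; congr (_ * _%:R); congr nat_of_bool.
apply: eq_forallb => y; rewrite implybE negbK; congr (_ || _).
by apply/eqP/codomP => [->|[[]]//]; exists tt.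
Qed.

Lemma eq_kmul (X : finType) (a a' b b' : kern C q X) s t :
  (forall u v, a u v = a' u v) -> (forall u v, b u v = b' u v) ->
  kmul a b s t = kmul a' b' s t.
Proof. by move=> aa bb; apply: eq_bigr => u _; rewrite aa bb. Qed.

Lemma eq_kemb (X Y : finType) (f g : X -> Y) (a b : kern C q X) s t :
  f =1 g -> (forall u v, a u v = b u v) -> kemb f a s t = kemb g b s t.
Proof.
move=> fg ab; rewrite /kemb ab.
have fgp u : pull f u = pull g u by apply/ffunP => x; rewrite !ffunE fg.
rewrite !fgp; congr (_ * _%:R); congr nat_of_bool; apply: eq_forallb => y.
by rewrite (eq_codom fg).
Qed.

Lemma embedM n L (a b : op R d q n) : (n <= L)%N ->
  embed_op L (a *m b) = embed_op L a *m embed_op L b.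
Proof.
move=> nL; apply: kofP => s t; rewrite kofM kof_embed//.
rewrite (eq_kmul _ _ (fun u v => kof_embed a u v nL) (fun u v => kof_embed b u v nL)).
rewrite -kemb_mul; last exact: iota_inj.
by apply: eq_kemb => // u v; rewrite kofM.
Qed.

Lemma embed1 n L : (n <= L)%N -> embed_op L (1%:M : op R d q n) = 1%:M.
Proof.
move=> nL; apply: kofP => s t; rewrite kof_embed// kof1 -(kemb_one C (@iota_site d n L)).
by apply: eq_kemb => // u v; rewrite kof1.
Qed.

Lemma embedP n L (c : C) (a b : op R d q n) :
  embed_op L (c *: a + b) = c *: embed_op L a + embed_op L b.
Proof. by apply/matrixP => i j; rewrite !mxE mulrDl mulrA. Qed.

HB.instance Definition _ n L := GRing.isLinear.Build C (op R d q n) (op R d q L) _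
  (@embed_op R d q n L) (@embedP n L).

Lemma embedD n L (a b : op R d q n) : embed_op L (a + b) = embed_op L a + embed_op L b.
Proof. exact: linearD. Qed.

Lemma embedB n L (a b : op R d q n) : embed_op L (a - b) = embed_op L a - embed_op L b.
Proof. exact: linearB. Qed.

Lemma embedZ n L (c : C) (a : op R d q n) : embed_op L (c *: a) = c *: embed_op L a.
Proof. exact: linearZ. Qed.

Lemma embed_sum n L (I : Type) (r : seq I) (P : pred I) (F : I -> op R d q n) :
  embed_op L (\sum_(i <- r | P i) F i) = \sum_(i <- r | P i) embed_op L (F i).
Proof. exact: linear_sum. Qed.

Lemma embed_adj n L (a : op R d q n) : embed_op L (adjmx a) = adjmx (embed_op L a).
Proof.
apply/matrixP => i j; rewrite !mxE rmorphM rmorph_nat; congr (_ * _%:R).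
congr nat_of_bool; apply: eq_forallb => y; by rewrite [(enum_val i) y == _]eq_sym.
Qed.

Lemma embed_comp n m L (a : op R d q n) : (n <= m)%N -> (m <= L)%N ->
  embed_op L (embed_op m a) = embed_op L a.
Proof.
move=> nm mL; apply: kofP => s t; rewrite !kof_embed// ?(leq_trans nm)//.
rewrite (eq_kemb (b := kemb (@iota_site d n m) (kof a)) _ _ (frefl _)); last first.
  by move=> u v; rewrite kof_embed.
rewrite kemb_comp; last exact: iota_inj.
by apply: eq_kemb => // x; exact: iota_comp.
Qed.

Lemma embed_id n (a : op R d q n) : embed_op n a = a.
Proof.
apply: kofP => s t; rewrite kof_embed// /kemb.
have pI u : pull (@iota_site d n n) u = u :> cfg d q n.
  by apply/ffunP => x; rewrite ffunE iota_id.
have -> : eq_off (@iota_site d n n) s t.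
  by apply/forallP => y; rewrite -(iota_id y) codom_f.
by rewrite !pI mulr1.
Qed.

Lemma embed_onsite n L (x : site d n) (A : 'M[C]_q) : (n <= L)%N ->
  embed_op L (onsite x A) = onsite (iota_site L x) A.
Proof.
move=> nL; apply: kofP => s t; rewrite kof_embed// kof_onsite.
rewrite (eq_kemb _ _ (frefl _) (kof_onsite x A)) kemb_comp//.
exact: iota_inj.
Qed.

Lemma onsite_commute n (x y : site d n) (A B : 'M[C]_q) : x != y ->
  onsite x A *m onsite y B = onsite y B *m onsite x A.
Proof.
move=> xy; apply: kofP => s t; rewrite !kofM.
rewrite (eq_kmul _ _ (kof_onsite x A) (kof_onsite y B)).
rewrite (eq_kmul _ _ (kof_onsite y B) (kof_onsite x A)).
exact: kemb_commute.
Qed.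

Lemma onsite_embed_commute n L (a : op R d q n) (y : site d L) (B : 'M[C]_q) :
  (n <= L)%N -> ~~ inbox n (coord y) ->
  onsite y B *m embed_op L a = embed_op L a *m onsite y B.
Proof.
move=> nL ny; apply: kofP => s t; rewrite !kofM.
rewrite (eq_kmul _ _ (kof_onsite y B) (fun u v => kof_embed a u v nL)).
rewrite (eq_kmul _ _ (fun u v => kof_embed a u v nL) (kof_onsite y B)).
apply: kemb_commute => u x'; apply: contra ny => /eqP yx.
by rewrite -[y]/(one_site y u) yx; exact: inbox_iota.
Qed.

Lemma onsiteP n (x : site d n) (c : C) (A B : 'M[C]_q) :
  onsite x (c *: A + B) = c *: onsite x A + onsite x B.
Proof. by apply/matrixP => i j; rewrite !mxE mulrDl mulrA. Qed.

HB.instance Definition _ n (x : site d n) :=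
  GRing.isLinear.Build C 'M[C]_q (op R d q n) _ (@onsite R d q n x) (@onsiteP n x).

Lemma onsiteD n (x : site d n) (A B : 'M[C]_q) :
  onsite x (A + B) = onsite x A + onsite x B.
Proof. exact: linearD. Qed.

Lemma onsiteZ n (x : site d n) (c : C) (A : 'M[C]_q) :
  onsite x (c *: A) = c *: onsite x A.
Proof. exact: linearZ. Qed.

Lemma onsiteM n (x : site d n) (A B : 'M[C]_q) :
  onsite x (A *m B) = onsite x A *m onsite x B.
Proof.
apply: kofP => s t; rewrite kofM kof_onsite.
rewrite (eq_kmul _ _ (kof_onsite x A) (kof_onsite x B)).
rewrite -kemb_mul; last by move=> [] [].
apply: eq_kemb => // u v; rewrite mxE /kmul.
rewrite (reindex (fun w : {ffun unit -> 'I_q} => w tt)) //.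
exists (fun k => [ffun=> k]) => [w _|k _]; last by rewrite ffunE.
by apply/ffunP => -[]; rewrite ffunE.
Qed.

Lemma onsite1 n (x : site d n) : onsite x (1%:M : 'M[C]_q) = 1%:M.
Proof.
apply: kofP => s t; rewrite kof_onsite kof1 -(kemb_one C (one_site x)).
apply: eq_kemb => // u v; rewrite mxE; congr _%:R; congr nat_of_bool.
apply/eqP/eqP => [e|->//]; by apply/ffunP => -[].
Qed.

Lemma onsite_adj n (x : site d n) (A : 'M[C]_q) : onsite x (adjmx A) = adjmx (onsite x A).
Proof.
apply/matrixP => i j; rewrite !mxE rmorphM rmorph_nat; congr (_ * _%:R).
congr nat_of_bool; apply: eq_forallb => y; by rewrite [(enum_val i) y == _]eq_sym.
Qed.

Section Vectors.
Variables (n : nat) (v : vec R d q n).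

Lemma expv_linear (c : C) (a b : op R d q n) :
  expv v (c *: a + b) = c * expv v a + expv v b.
Proof. by rewrite /expv mulmxDr mulmxDl -scalemxAr -scalemxAl !mxE. Qed.

Lemma expv_ge0 (a : op R d q n) : 0 <= expv v (adjmx a *m a).
Proof.
rewrite /expv mulmxA -mulmxA -adjmxM mxE sumr_ge0// => i _.
by rewrite !mxE mulrC mul_conjC_ge0.
Qed.

Lemma expv_kof (A : op R d q n) : expv v A =
  \sum_s \sum_t (v (enum_rank s) ord0)^* * kof A s t * v (enum_rank t) ord0.
Proof.
rewrite /expv mxE [RHS]exchange_big /= (reindex enum_rank); last first.
  by apply: onW_bij; exact: enum_rank_bij.
apply: eq_bigr => t _; rewrite mxE mulr_suml (reindex enum_rank) /=; last first.
  by apply: onW_bij; exact: enum_rank_bij.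
by apply: eq_bigr => s _; rewrite !mxE.
Qed.

End Vectors.

Lemma shift2_bij n (i : 'I_d) : bijective (@shift2 d n i).
Proof.
exists (fun x : site d n => [ffun j => if j == i then ord_pred (ord_pred (x j)) else x j]) => x;
  apply/ffunP => j; rewrite !ffunE; case: eqP => // _.
  by rewrite !ordSK.
by rewrite !ord_predK.
Qed.

(** Reindexing both sums over configurations by the translation leaves the amplitudes of [v]
    unchanged and replaces [A] by its translate [B]. *)
Lemma expv_shift2 n (v : vec R d q n) (A B : op R d q n) (i : 'I_d) :
  trans2_inv v ->
  (forall s t, kof A (pull (@shift2 d n i) s) (pull (@shift2 d n i) t) = kof B s t) ->
  expv v A = expv v B.
Proof.
move=> vT AB; rewrite !expv_kof.
have pb : bijective (pull (@shift2 d n i) : cfg d q n -> cfg d q n).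
  exact: pull_bij (shift2_bij n i).
rewrite (reindex _ (onW_bij _ pb)); apply: eq_bigr => s _.
rewrite (reindex _ (onW_bij _ pb)); apply: eq_bigr => t _.
by rewrite AB; congr (_ ^* * _ * _); exact: vT.
Qed.

Lemma kof_onsite_shift2 n (x : site d n) (A : 'M[C]_q) i s t :
  kof (onsite x A) (pull (@shift2 d n i) s) (pull (@shift2 d n i) t) =
  kof (onsite (shift2 i x) A) s t.
Proof. by rewrite !kof_onsite kemb_pull//; exact: shift2_bij. Qed.

Lemma kof_onsite2_shift2 n (x y : site d n) (A B : 'M[C]_q) i s t :
  kof (onsite x A *m onsite y B) (pull (@shift2 d n i) s) (pull (@shift2 d n i) t) =
  kof (onsite (shift2 i x) A *m onsite (shift2 i y) B) s t.
Proof.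
rewrite !kofM /kmul.
have pb : bijective (pull (@shift2 d n i) : cfg d q n -> cfg d q n).
  exact: pull_bij (shift2_bij n i).
by rewrite (reindex _ (onW_bij _ pb)); apply: eq_bigr => u _; rewrite !kof_onsite_shift2.
Qed.

End Operators.

(** * States and boundary estimates *)

Section StatesAndHamiltonian.
Variables (R : realType) (d q : nat).
Local Notation C := R[i].
Local Notation coord := Defs.coord.

(* The real part of a state on the algebra of one box, as a real-linear functional. *)
Record rstate n (r : op R d q n -> R) : Prop := Rstate {
  rstateD : forall a b : op R d q n, r (a + b) = r a + r b;
  rstateZ : forall (c : R) (a : op R d q n), r ((c%:C)%C *: a) = c * r a;
  rstate_ge0 : forall a : op R d q n, 0 <= r (adjmx a *m a);
  rstate1 : r 1%:M = 1 }.

Section RealState.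
Variables (n : nat) (r : op R d q n -> R).
Hypothesis rP : rstate r.

Lemma rstate0 : r 0 = 0.
Proof. by have := rstateZ rP 0 0; rewrite mul0r scaler0. Qed.

Lemma rstateN a : r (- a) = - r a.
Proof. by apply/eqP; rewrite -addr_eq0 addrC -rstateD// subrr rstate0. Qed.

Lemma rstateB a b : r (a - b) = r a - r b.
Proof. by rewrite rstateD// rstateN. Qed.

Lemma rstate_sum (I : Type) (s : seq I) (P : pred I) (F : I -> op R d q n) :
  r (\sum_(i <- s | P i) F i) = \sum_(i <- s | P i) r (F i).
Proof. by apply: big_morph => [a b|]; [exact: rstateD|exact: rstate0]. Qed.

End RealState.

Lemma ReM (c : R) (z : C) : complex.Re ((c%:C)%C * z) = c * complex.Re z.
Proof. by case: z => a b /=; rewrite mul0r subr0. Qed.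

Lemma ReD (y z : C) : complex.Re (y + z) = complex.Re y + complex.Re z.
Proof. by case: y z => a b [a' b']. Qed.

Lemma Re_ge0 (z : C) : 0 <= z -> 0 <= complex.Re z.
Proof. by case: z => a b; rewrite lecE /= => /andP[]. Qed.

Lemma rstate_state n (w : op R d q n -> C) :
  (forall (c : C) (a b : op R d q n), w (c *: a + b) = c * w a + w b) ->
  (forall a : op R d q n, 0 <= w (adjmx a *m a)) -> w 1%:M = 1 -> rstate (fun a => complex.Re (w a)).
Proof.
move=> wL wp w1.
have w0 : w 0 = 0 by have := wL (-1) 0 0; rewrite scaler0 addr0 mulN1r addNr.
split=> [a b|c a|a|]; last by rewrite w1.
- by rewrite -{1}[a]scale1r wL mul1r ReD.
- by rewrite -[_ *: a]addr0 wL w0 addr0 ReM.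
- exact: Re_ge0.
Qed.

Lemma rstate_expv n (v : vec R d q n) : adjmx v *m v = 1 ->
  rstate (fun a => complex.Re (expv v a)).
Proof.
move=> v1; apply: rstate_state => [c a b|a|]; [exact: expv_linear|exact: expv_ge0|].
by rewrite /expv mulmx1 v1 mxE.
Qed.

Lemma rstate_embed n L (r : op R d q L -> R) : (n <= L)%N -> rstate r ->
  rstate (fun a : op R d q n => r (embed_op L a)).
Proof.
move=> nL rP; split=> [a b|c a|a|].
- by rewrite embedD (rstateD rP).
- by rewrite embedZ (rstateZ rP).
- by rewrite embedM// embed_adj (rstate_ge0 rP).
- by rewrite embed1// (rstate1 rP).
Qed.

Variables S1 S2 S3 : 'M[C]_q.
Hypothesis herm : adjmx S1 = S1 /\ adjmx S2 = S2 /\ adjmx S3 = S3.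
Variable s : R.
Hypothesis casimir : S1 *m S1 + S2 *m S2 + S3 *m S3 = ((s%:C)%C)%:M.

Definition bond n (x y : site d n) : op R d q n :=
  onsite x S1 *m onsite y S1 + onsite x S2 *m onsite y S2 + onsite x S3 *m onsite y S3.

(** The sign of [stag] taken in [R], since an [rstate] is only real-linear and can pull out real
    factors only. *)
Definition sgs n (x : site d n) : R := (-1) ^ (\sum_i coord x i).

Lemma sgsE n (x : site d n) : (-1 : C) ^ (\sum_i coord x i) = ((sgs x)%:C)%C.
Proof.
have h k : (-1 : C) ^+ k = (((-1) ^+ k : R)%:C)%C by rewrite rmorphXn rmorphN1.
rewrite /sgs; case: (\sum_i coord x i) => k; first exact: h.
by rewrite !NegzE -!exprnN h -fmorphV.
Qed.

Lemma norm_sgs n (x : site d n) : `|sgs x| = 1.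
Proof.
rewrite /sgs; case: (\sum_i coord x i) => k; first by rewrite normrX normrN1 expr1n.
by rewrite NegzE -exprnN normrV ?unitrX ?unitrN1// normrX normrN1 expr1n invr1.
Qed.

Lemma sgs_iota n L (x : site d n) : (n <= L)%N -> sgs (iota_site L x) = sgs x.
Proof. by move=> nL; congr (_ ^ _); apply: eq_bigr => i _; rewrite coord_iota. Qed.

Lemma stagE n : stag d S3 n = \sum_(x : site d n) ((sgs x)%:C)%C *: onsite x S3.
Proof. by apply: eq_bigr => x _; rewrite sgsE. Qed.

Lemma H0E n : H0 d S1 S2 S3 n =
  ((2^-1 : R)%:C)%C *: \sum_(x : site d n) \sum_(y | adj x y) bond x y.
Proof. by rewrite /H0 fmorphV rmorph_nat. Qed.

Lemma bond_sym n (x y : site d n) : adj x y -> bond x y = bond y x.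
Proof.
move/adj_neq => xy; rewrite /bond.
exact: (congr2 +%R (congr2 +%R (onsite_commute S1 S1 xy) (onsite_commute S2 S2 xy))
  (onsite_commute S3 S3 xy)).
Qed.

Lemma embed_bond n L (x y : site d n) : (n <= L)%N ->
  embed_op L (bond x y) = bond (iota_site L x) (iota_site L y).
Proof. by move=> nL; rewrite !embedD !(embedM _ _ nL) !(embed_onsite _ _ nL). Qed.

Lemma casimir_site n (r : op R d q n -> R) (x : site d n) : rstate r ->
  r (onsite x S1 *m onsite x S1) + r (onsite x S2 *m onsite x S2) +
  r (onsite x S3 *m onsite x S3) = s.
Proof.
move=> rP; rewrite -!(rstateD rP).
have -> : onsite x S1 *m onsite x S1 + onsite x S2 *m onsite x S2 +
    onsite x S3 *m onsite x S3 = onsite x (S1 *m S1 + S2 *m S2 + S3 *m S3).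
  by rewrite !onsiteD !onsiteM.
by rewrite casimir -scalemx1 onsiteZ onsite1 (rstateZ rP) (rstate1 rP) mulr1.
Qed.

(** Positivity on the squares of [X + Y] and [X - Y] gives the two signs. *)
Lemma rstate_sqr n (r : op R d q n -> R) (X Y : op R d q n) : rstate r ->
  adjmx X = X -> adjmx Y = Y -> X *m Y = Y *m X ->
  `|r (X *m Y)| <= (r (X *m X) + r (Y *m Y)) / 2.
Proof.
move=> rP hX hY XY.
have := rstate_ge0 rP (X + Y); have := rstate_ge0 rP (X - Y).
rewrite adjmxB adjmxD hX hY !mulmxDl !mulmxDr !mulNmx !mulmxN opprK -XY.
by rewrite !(rstateD rP) !(rstateN rP) ler_norml => ? ?; apply/andP; split; lra.
Qed.

Lemma norm_add3_le (a1 a2 a3 x1 x2 x3 y1 y2 y3 : R) :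
  `|a1| <= (x1 + y1) / 2 -> `|a2| <= (x2 + y2) / 2 -> `|a3| <= (x3 + y3) / 2 ->
  x1 + x2 + x3 = s -> y1 + y2 + y3 = s -> `|a1 + a2 + a3| <= s.
Proof.
by rewrite !ler_norml => /andP[? ?] /andP[? ?] /andP[? ?] ? ?; apply/andP; split; lra.
Qed.

(** [rstate_sqr] is applied to each spin component; summed over the three components, the squares at
    either site give the Casimir constant [s], which is S(S+1). *)
Lemma rstate_bond n (r : op R d q n -> R) (x y : site d n) : rstate r -> adj x y ->
  `|r (bond x y)| <= s.
Proof.
move=> rP /adj_neq xy; have [h1 [h2 h3]] := herm.
have cx := casimir_site x rP; have cy := casimir_site y rP.
have B (A : 'M[C]_q) : adjmx A = A -> `|r (onsite x A *m onsite y A)| <=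
    (r (onsite x A *m onsite x A) + r (onsite y A *m onsite y A)) / 2.
  move=> hA; apply: (rstate_sqr rP); last exact: onsite_commute.
    by rewrite -onsite_adj hA.
  by rewrite -onsite_adj hA.
rewrite !(rstateD rP).
exact: norm_add3_le (B _ h1) (B _ h2) (B _ h3) cx cy.
Qed.

(** [rstate_sqr] is applied to the third component and the identity; the square of that component is
    at most [s] because the other two squares are positive. *)
Lemma rstate_onsite n (r : op R d q n -> R) (x : site d n) : rstate r ->
  `|r (onsite x S3)| <= (1 + s) / 2.
Proof.
move=> rP; have [h1 [h2 h3]] := herm.
have hX : adjmx (onsite x S3) = onsite x S3 by rewrite -onsite_adj h3.
have comm1 : onsite x S3 *m 1%:M = 1%:M *m onsite x S3 by rewrite mulmx1 mul1mx.
have := rstate_sqr rP hX (adjmx1 _ _) comm1.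
rewrite !mulmx1 (rstate1 rP) => /le_trans; apply.
have := casimir_site x rP; have := rstate_ge0 rP (onsite x S1).
have := rstate_ge0 rP (onsite x S2); rewrite -!onsite_adj h1 h2; lra.
Qed.

Lemma casimir_ge0 n (r : op R d q n -> R) (x : site d n) : rstate r -> 0 <= s.
Proof.
move=> rP; have [h1 [h2 h3]] := herm; rewrite -(casimir_site x rP).
have := rstate_ge0 rP (onsite x S1); have := rstate_ge0 rP (onsite x S2).
by have := rstate_ge0 rP (onsite x S3); rewrite -!onsite_adj h1 h2 h3; lra.
Qed.

Definition nbr n (r : op R d q n -> R) (x : site d n) : R :=
  \sum_(y | adj x y) r (bond x y).

Lemma nbr_le (T : finType) (P : pred T) (F : T -> R) (k : nat) : (#|P| <= k)%N -> 0 <= s ->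
  (forall y, P y -> `|F y| <= s) -> `|\sum_(y | P y) F y| <= k%:R * s.
Proof.
move=> Pk s0 Fs; apply: le_trans (ler_norm_sum _ _ _) _.
apply: le_trans (ler_sum _ Fs) _; rewrite sumr_const -[s *+ _]mulr_natl ler_wpM2r//.
by rewrite ler_nat.
Qed.

Lemma rstate_H0 n (r : op R d q n -> R) : rstate r ->
  r (H0 d S1 S2 S3 n) = 2^-1 * \sum_x nbr r x.
Proof.
move=> rP; rewrite H0E rstateZ// rstate_sum//; congr (_ * _).
by apply: eq_bigr => x _; rewrite rstate_sum.
Qed.

Lemma rstate_stag n (r : op R d q n -> R) : rstate r ->
  r (stag d S3 n) = \sum_x sgs x * r (onsite x S3).
Proof.
by move=> rP; rewrite stagE rstate_sum//; apply: eq_bigr => x _; rewrite rstateZ.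
Qed.

Lemma nbr_bound n (r : op R d q n -> R) (x : site d n) : rstate r ->
  `|nbr r x| <= d.*2%:R * s.
Proof.
move=> rP; apply: nbr_le; [exact: card_adj|exact: casimir_ge0 x rP|].
by move=> y; exact: rstate_bond.
Qed.

(* Only the sites next to the boundary see that the periodic boundary
   condition of the smaller box is absent in the larger one. *)
Lemma embed_H0_approx n L (r : op R d q L -> R) : (n < L)%N -> rstate r ->
  `|r (embed_op L (H0 d S1 S2 S3 n.+1)) -
    2^-1 * \sum_(x : site d n.+1) nbr r (iota_site L x)| <=
  d.*2%:R * s * (vol d n.+1 - vol d n)%N%:R.
Proof.
move=> nL rP; pose r' (a : op R d q n.+1) := r (embed_op L a).
have rP' : rstate r' by exact: rstate_embed.
rewrite -[r _]/(r' _) rstate_H0// -mulrBr -sumrB.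
rewrite (bigID (fun x : site d n.+1 => inbox n (coord x))) /= big1 ?add0r; last first.
  move=> x xn; rewrite {2}/nbr (sum_adj_iota _ (leqnn _) nL xn).
  rewrite -sumrB big1// => y _; by rewrite /r' embed_bond// subrr.
(* A boundary site contributes the difference of two local energies, each at most 2ds in absolute
   value, and the prefactor 1/2 brings this back to 2ds per site. *)
rewrite normrM -(card_outside d (leqnSn n)) natr_sum mulr_sumr ger0_norm ?invr_ge0//.
rewrite ler_pdivrMl// mulr_sumr; apply: le_trans (ler_norm_sum _ _ _) _.
apply: ler_sum => x _; rewrite mulr1.
apply: le_trans (ler_normB _ _) _.
have := nbr_bound x rP'; have := nbr_bound (iota_site L x) rP; lra.
Qed.

(** Two layers add up: the sites between boxes [n] and [n.+1] see the periodic bonds of the smaller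
    box, and those between [n.+1] and [n.+2] carry bonds it lacks. *)
Lemma H0_succ_approx n (r : op R d q n.+2 -> R) : rstate r ->
  `|r (embed_op n.+2 (H0 d S1 S2 S3 n.+1)) - r (H0 d S1 S2 S3 n.+2)| <=
  d.*2%:R * s * (vol d n.+2 - vol d n)%N%:R.
Proof.
move=> rP; have := embed_H0_approx (leqnSn n.+1) rP.
rewrite (rstate_H0 rP) (sum_site_iota (nbr r) (leqnSn n.+1)) mulrDr.
set A := r (embed_op _ _); set B := 2^-1 * _; set D := \sum_(z | _) _ => AB.
have D_le : `|D| <= d.*2%:R * s * (vol d n.+2 - vol d n.+1)%N%:R.
  rewrite -(card_outside d (leqnSn n.+1)) natr_sum mulr_sumr.
  apply: le_trans (ler_norm_sum _ _ _) _; apply: ler_sum => x _; rewrite mulr1.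
  exact: nbr_bound.
have volS k : (vol d k <= vol d k.+1)%N by apply: vol_le.
rewrite opprD addrA; apply: le_trans (ler_normB _ _) _.
rewrite normrM ger0_norm ?invr_ge0//.
have -> : (vol d n.+2 - vol d n = (vol d n.+2 - vol d n.+1) + (vol d n.+1 - vol d n))%N.
  by have := volS n; have := volS n.+1; lia.
rewrite natrD mulrDr; have := normr_ge0 D; lra.
Qed.

End StatesAndHamiltonian.

(** * Functions of period two *)

Section EvenPeriodic.
Variable d : nat.
Local Notation coord := Defs.coord.

Definition shift2_inv (T : Type) n (G : site d n -> T) : Prop :=
  forall i x, G (shift2 i x) = G x.

Definition reduce2 n (y : site d n) : site d n :=
  [ffun j => inord (odd (y j))].

Lemma val_reduce2 n (y : site d n) j : (reduce2 y j : nat) = odd (y j).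
Proof.
rewrite ffunE.
have lt : (odd (y j) < (n.+1).*2)%N by case: (odd _).
by rewrite inordK.
Qed.

(** Descent on the sum of the coordinates: a coordinate that is at least 2 is lowered by 2, and
    shifting back does not wrap around, until only 0 and 1 remain. *)
Lemma shift2_inv_reduce (T : Type) n (G : site d n -> T) y :
  shift2_inv G -> G (reduce2 y) = G y.
Proof.
move=> GT; have [k] := ubnP (\sum_j (y j : nat))%N; elim: k y => // k IH y yk.
case: (pickP (fun i => 2 <= y i)%N) => [i yi|small]; last first.
  congr G; apply/ffunP => j; apply: val_inj; rewrite /= val_reduce2.
  by have := small j; case: (nat_of_ord (y j)) => [|[|]].
have lt : (y i - 2 < (n.+1).*2)%N by have := ltn_ord (y i); lia.
pose z : site d n := [ffun j => if j == i then Ordinal lt else y j].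
have yz : shift2 i z = y.
  have vS (c : 'I_(n.+1).*2) : (c.+1 < (n.+1).*2)%N -> (ordS c : nat) = c.+1.
    by move=> ?; rewrite /= modn_small.
  apply/ffunP => j; rewrite !ffunE; case: eqP => [->|//]; apply: ord_inj.
  have ? := ltn_ord (y i).
  have v1 : (ordS (Ordinal lt) : nat) = (y i - 2).+1 by rewrite vS /=; lia.
  rewrite [LHS]vS; rewrite v1; move: yi lt {vS v1 z}; (have := ltn_ord (y i));
    by move: (nat_of_ord (y i)) => a; lia.
rewrite -yz GT.
have -> : reduce2 (shift2 i z) = reduce2 z.
  rewrite yz; apply/ffunP => j; apply: val_inj; rewrite /= !val_reduce2.
  by rewrite ffunE; case: eqP => [->|//] /=; rewrite oddB// addbF.
apply: IH; rewrite ltnS in yk; apply: leq_trans yk.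
rewrite (bigD1 i) //= [X in (_ < X)%N](bigD1 i) //= ffunE eqxx /=.
rewrite (eq_bigr (fun j => y j : nat)).
  by move: yi (\sum_(_ < d | _) _)%N; move: (nat_of_ord (y i)) => a; lia.
by move=> j /negPf ji; rewrite ffunE ji.
Qed.

Lemma shift2_inv_odd (T : Type) n (G : site d n -> T) (y z : site d n) :
  shift2_inv G -> (forall j, odd (y j) = odd (z j)) -> G y = G z.
Proof.
move=> GT yz; rewrite -(shift2_inv_reduce y GT) -(shift2_inv_reduce z GT).
congr G; apply/ffunP => j; apply: val_inj; by rewrite /= !val_reduce2 yz.
Qed.

(** The parity class of [x]: [x i + n] has the parity of the integer coordinate [x i - n], and the
    box with index 0, of side 2, has exactly one site per class. *)
Definition cell n (x : site d n) : site d 0 := [ffun i => inord (odd (x i + n))].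

Lemma val_cell n (x : site d n) i : (cell x i : nat) = odd (x i + n).
Proof.
rewrite ffunE; have lt : (odd (x i + n) < 1.*2)%N by case: (odd _).
by rewrite inordK.
Qed.

Lemma count_parity n m (e : bool) :
  (\sum_(k < m.*2) (odd (k + n) == e) = m)%N.
Proof.
elim: m => [|m IH]; first by rewrite big_ord0.
rewrite doubleS !big_ord_recr /= IH.
by rewrite !oddD /= odd_double; clear IH; case: (odd n); case: e; lia.
Qed.

Lemma card_cell n (b : site d 0) : #|[pred x : site d n | cell x == b]| = (n.+1 ^ d)%N.
Proof.
rewrite -sum1_card big_mkcond /=.
(* The indicator of a parity class is a product over the coordinates, so the count becomes a power
   of a one-dimensional count. *)
transitivity (\sum_(f : site d n) \prod_i (odd (f i + n) == (b i == 1 :> nat)))%N.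
  apply: eq_bigr => f _; rewrite inE.
  case: eqP => [fb|fb].
    rewrite big1// => i _; rewrite -fb val_cell; by case: (odd _).
  have : [exists i, cell f i != b i].
    rewrite -negb_forall; apply: contra_notN fb => /forallP H.
    by apply/ffunP => i; apply/eqP.
  case/existsP => i; rewrite -val_eqE /= val_cell (bigD1 i) //= => ne.
  have /negPf -> : odd (f i + n) != (b i == 1 :> nat); last by rewrite mul0n.
  by move: ne; have := ltn_ord (b i); case: (odd _); case: (nat_of_ord (b i)) => [|[|]].
rewrite -(bigA_distr_bigA (fun i (k : 'I_(n.+1).*2) =>
   nat_of_bool (odd (k + n) == (b i == 1 :> nat)))) /=.
under eq_bigr do rewrite count_parity.
by rewrite prod_nat_const card_ord.
Qed.

(** A function of period two depends only on the parity class, and all classes have the same number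
    of sites in every box. Averages over boxes are therefore exactly independent of the box. *)
Lemma sum_shift2_inv (R : numDomainType) n L (G : site d L -> R) : (n <= L)%N ->
  shift2_inv G ->
  \sum_(x : site d n) G (iota_site L x) =
  (n.+1 ^ d)%N%:R * \sum_(b : site d 0) G (iota_site L b).
Proof.
move=> nL GT; rewrite (partition_big (@cell n) xpredT) //= mulr_sumr.
apply: eq_bigr => b _; rewrite (eq_bigr (fun=> G (iota_site L b))); last first.
  move=> x /eqP <-; apply: shift2_inv_odd => // j.
  by rewrite !val_iota// val_cell !oddD !oddB// oddb; case: (odd _); case: (odd _); case: (odd _).
by rewrite sumr_const card_cell mulr_natl.
Qed.

Lemma volE n : vol d n = ((n.+1 ^ d) * vol d 0)%N.
Proof. by rewrite /vol -muln2 expnMn. Qed.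

Lemma vol_gt0 n : (0 < vol d n)%N.
Proof. by rewrite expn_gt0. Qed.

Lemma avg_shift2_inv (R : numFieldType) n L (G : site d L -> R) : (n <= L)%N ->
  shift2_inv G ->
  (\sum_(x : site d n) G (iota_site L x)) / (vol d n)%:R =
  (\sum_(x : site d L) G x) / (vol d L)%:R.
Proof.
move=> nL GT.
have -> : \sum_(x : site d L) G x = \sum_(x : site d L) G (iota_site L x).
  by apply: eq_bigr => x _; rewrite iota_id.
rewrite (sum_shift2_inv nL GT) (sum_shift2_inv (leqnn L) GT) (volE n) (volE L) !natrM.
have nz k : (k.+1 ^ d)%N%:R != 0 :> R by rewrite pnatr_eq0 -lt0n expn_gt0.
by rewrite -!mulf_div !divff ?nz// !mul1r.
Qed.

End EvenPeriodic.

(** * Locality of commutators *)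

Section Locality.
Variables (R : realType) (d q : nat).
Local Notation C := R[i].
Local Notation coord := Defs.coord.
Variables S1 S2 S3 : 'M[C]_q.

Definition comm_mx2 n (X Y : 'M[C]_n) : 'M[C]_n := X *m Y - Y *m X.

Lemma comm_mx2_sum n (I : finType) (P : pred I) (F : I -> 'M[C]_n) (Y : 'M[C]_n) :
  comm_mx2 (\sum_(i | P i) F i) Y = \sum_(i | P i) comm_mx2 (F i) Y.
Proof. by rewrite /comm_mx2 mulmx_suml mulmx_sumr -sumrB. Qed.

Lemma comm_mx2Z n (c : C) (X Y : 'M[C]_n) : comm_mx2 (c *: X) Y = c *: comm_mx2 X Y.
Proof. by rewrite /comm_mx2 -scalemxAl -scalemxAr scalerBr. Qed.

Lemma comm_mx2B n (X X' Y : 'M[C]_n) : comm_mx2 (X - X') Y = comm_mx2 X Y - comm_mx2 X' Y.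
Proof. by rewrite /comm_mx2 mulmxBl mulmxBr !opprB addrACA [RHS]addrACA; congr (_ + _); exact: addrC. Qed.

Lemma embed_comm n L (X Y : op R d q n) : (n <= L)%N ->
  embed_op L (comm_mx2 X Y) = comm_mx2 (embed_op L X) (embed_op L Y).
Proof. by move=> nL; rewrite embedB !(embedM _ _ nL). Qed.

Lemma sum_inbox (V : zmodType) n L (F : site d L -> V) : (n <= L)%N ->
  \sum_(z : site d L | inbox n (coord z)) F z = \sum_(x : site d n) F (iota_site L x).
Proof.
move=> nL; apply: (addIr (\sum_(z : site d L | ~~ inbox n (coord z)) F z)).
by rewrite -sum_site_iota// [RHS](bigID (fun z : site d L => inbox n (coord z))).
Qed.

(** A bond inside the box is met from both of its ends, a bond crossing the boundary only from its
    inner end; the multiplicity 1 or 2 compensates for this. *)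
Lemma sum_adj_inbox (V : zmodType) n L (F : site d L -> site d L -> V) : (n <= L)%N ->
  (forall x y, adj x y -> F x y = F y x) ->
  (forall x y, adj x y -> ~~ inbox n (coord x) -> ~~ inbox n (coord y) -> F x y = 0) ->
  \sum_x \sum_(y | adj x y) F x y =
  \sum_(x : site d n) \sum_(y | adj (iota_site L x) y)
     F (iota_site L x) y *+ (~~ inbox n (coord y)).+1.
Proof.
move=> nL Fs F0.
rewrite -(sum_inbox (fun x => \sum_(y | adj x y) F x y *+ (~~ inbox n (coord y)).+1) nL).
rewrite [LHS](bigID (fun z : site d L => inbox n (coord z))) /=.
under [RHS]eq_bigr do (under eq_bigr do rewrite mulrS; rewrite big_split /=).
rewrite [RHS]big_split /=; congr (_ + _).
transitivity (\sum_(x : site d L | ~~ inbox n (coord x))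
   \sum_(y | inbox n (coord y) && adj x y) F x y).
  apply: eq_bigr => x nx; rewrite (bigID (fun z : site d L => inbox n (coord z))) /=.
  rewrite [X in _ + X]big1 ?addr0; first by apply: eq_bigl => y; rewrite andbC.
  by move=> y /andP[xy ny]; exact: F0.
rewrite (exchange_big_dep (fun y : site d L => inbox n (coord y))) /=; last first.
  by move=> x y _ /andP[].
apply: eq_bigr => y yn; rewrite [RHS](bigID (fun z : site d L => inbox n (coord z))) /=.
rewrite [X in _ = X + _]big1 ?add0r; last by move=> x /andP[_ ->].
apply: eq_big => [x|x /andP[nx /andP[_ xy]]]; last by rewrite nx Fs.
by rewrite yn /= adj_sym andbC.
Qed.

Lemma bond_embed_commute n L (a : op R d q n) (x y : site d L) : (n <= L)%N ->
  ~~ inbox n (coord x) -> ~~ inbox n (coord y) ->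
  comm_mx2 (bond S1 S2 S3 x y) (embed_op L a) = 0.
Proof.
move=> nL nx ny.
have H (A B : 'M[C]_q) : onsite x A *m onsite y B *m embed_op L a =
    embed_op L a *m (onsite x A *m onsite y B).
  by rewrite -mulmxA (onsite_embed_commute a B nL ny) !mulmxA (onsite_embed_commute a A nL nx).
by rewrite /comm_mx2 /bond !mulmxDl !mulmxDr !H subrr.
Qed.

(** Bonds missing box [n] commute with [a]. The others have an end in box [n], so they lie in box
    [m] and are the same bonds there as in box [L]. *)
Lemma comm_H0_local n m L (a : op R d q n) : (n < m)%N -> (m <= L)%N ->
  comm_mx2 (H0 d S1 S2 S3 L) (embed_op L a) =
  embed_op L (comm_mx2 (H0 d S1 S2 S3 m) (embed_op m a)).
Proof.
move=> nm mL; have nm' := ltnW nm; have nL := leq_trans nm' mL.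
rewrite !H0E !comm_mx2Z embedZ; congr (_ *: _).
rewrite !comm_mx2_sum embed_sum.
under eq_bigr do rewrite comm_mx2_sum.
under [RHS]eq_bigr do rewrite comm_mx2_sum embed_sum.
rewrite (sum_adj_inbox nL); first last.
- by move=> x y xy nx ny; exact: bond_embed_commute.
- by move=> x y xy; rewrite bond_sym.
rewrite (sum_adj_inbox nm'); first last.
- by move=> x y xy nx ny; rewrite bond_embed_commute// linear0.
- by move=> x y xy; rewrite bond_sym.
apply: eq_bigr => x _; rewrite -{1 2}(iota_comp x nm' mL).
rewrite (sum_adj_iota _ nm mL (inbox_iota x nm')).
apply: eq_bigr => y _; rewrite (embed_comm _ _ mL) (embed_comp _ nm' mL) embed_bond//.
congr (_ *+ _.+1); congr nat_of_bool; congr negb.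
by apply: eq_forallb => i; rewrite coord_iota.
Qed.

Lemma comm_stag_local n m L (a : op R d q n) : (n <= m)%N -> (m <= L)%N ->
  comm_mx2 (stag d S3 L) (embed_op L a) =
  embed_op L (comm_mx2 (stag d S3 m) (embed_op m a)).
Proof.
move=> nm mL; have nL := leq_trans nm mL.
rewrite !stagE !comm_mx2_sum embed_sum (sum_site_iota _ mL) [X in _ + X]big1 ?addr0.
  apply: eq_bigr => x _; rewrite (embed_comm _ _ mL) (embed_comp _ nm mL).
  by rewrite embedZ (embed_onsite x S3 mL) (sgs_iota R x mL).
move=> z nz; rewrite comm_mx2Z /comm_mx2 (onsite_embed_commute a S3 nL) ?subrr ?scaler0//.
apply: contra nz => /(inbox_ex nL)[x ->].
by rewrite -(iota_comp x nm mL) inbox_iota.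
Qed.

End Locality.

(** * Variational principles *)

Section Spectral.
Variable R : realType.
Local Notation C := R[i].

(** After unitary diagonalization every diagonal entry is an eigenvalue, hence at least [E]; [K] is
    the square root of the shifted diagonal times the diagonalizing matrix. *)
Lemma ground_psd n (H : 'M[C]_n) (E : C) : adjmx H = H ->
  (forall (mu : C) (w : 'cV[C]_n), w != 0 -> H *m w = mu *: w -> E <= mu) ->
  exists K : 'M[C]_n, H - E%:M = adjmx K *m K.
Proof.
move=> hH Emin.
have hermH : H \is hermsymmx.
  by apply/is_hermitianmxP; rewrite expr0 scale1r -{1}hH /adjmx map_trmx.
have /orthomx_spectralP := hermitian_normalmx hermH.
have PU := spectral_unitarymx H.
move: (spectralmx H) (spectral_diag H) PU => P sp PU.
rewrite (invmx_unitary PU) => Hsp.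
have aP : adjmx P = map_mx Num.conj P^T by rewrite /adjmx map_trmx.
rewrite -aP in Hsp.
have PP : P *m adjmx P = 1%:M by rewrite aP; apply/unitarymxP.
have PP' : adjmx P *m P = 1%:M by exact: mulmx1C.
have Esp j : E <= sp 0 j.
  apply: (Emin _ (adjmx P *m delta_mx j 0)).
    apply/eqP => e0; have := congr1 (fun X => P *m X) e0.
    rewrite mulmxA PP mulmx0 mul1mx => /colP/(_ j); rewrite !mxE !eqxx => /eqP.
    by rewrite oner_eq0.
  rewrite [in LHS]Hsp !mulmxA -[X in X *m delta_mx j 0]mulmxA PP mulmx1 -mulmxA scalemxAr.
  congr (_ *m _); apply/colP => i; rewrite mul_diag_mx !mxE.
  by case: eqVneq => [->//|_]; rewrite !mulr0.
exists (diag_mx (\row_j sqrtC (sp 0 j - E)) *m P).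
rewrite adjmxM -mulmxA [X in adjmx P *m X]mulmxA.
have -> : adjmx (diag_mx (\row_j sqrtC (sp 0 j - E))) *m diag_mx (\row_j sqrtC (sp 0 j - E))
    = diag_mx sp - E%:M.
  rewrite /adjmx map_diag_mx tr_diag_mx mulmx_diag.
  apply/matrixP => i j; rewrite !mxE.
  case: eqVneq => [->|_]; last by rewrite !mulr0n subr0.
  rewrite !mulr1n; transitivity ((sqrtC (sp 0 j - E))^* * sqrtC (sp 0 j - E)); first by [].
  rewrite conj_Creal ?ger0_real ?sqrtC_ge0 ?subr_ge0//.
  by rewrite -expr2 sqrtCK.
rewrite mulmxBl mulmxBr mulmxA -Hsp mul_scalar_mx -scalemxAr PP'.
by rewrite scalemx1.
Qed.

End Spectral.

Section Ground.
Variables (R : realType) (d q : nat).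
Local Notation C := R[i].
Variable n : nat.

Lemma expvZ (v : vec R d q n) c (a : op R d q n) : expv v (c *: a) = c * expv v a.
Proof. by rewrite /expv -scalemxAr -scalemxAl mxE. Qed.

Lemma expvD (v : vec R d q n) (a b : op R d q n) : expv v (a + b) = expv v a + expv v b.
Proof. by rewrite /expv mulmxDr mulmxDl mxE. Qed.

Lemma expvB (v : vec R d q n) (a b : op R d q n) : expv v (a - b) = expv v a - expv v b.
Proof. by rewrite /expv mulmxBr mulmxBl !mxE. Qed.

Lemma expv1 (v : vec R d q n) : adjmx v *m v = 1 -> expv v 1%:M = 1.
Proof. by move=> v1; rewrite /expv mulmx1 v1 mxE. Qed.

Lemma expv_adj (v : vec R d q n) (a : op R d q n) : expv v (adjmx a) = (expv v a)^*.
Proof.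
have aE (X : 'M[C]_1) : (X ord0 ord0)^* = adjmx X ord0 ord0 by rewrite !mxE.
rewrite /expv aE.
by rewrite !adjmxM adjmxK mulmxA.
Qed.

Variables (H : op R d q n) (v : vec R d q n).
Hypothesis hH : adjmx H = H.
Hypothesis vH : ground_vec H v.

Lemma ground_sqrt : exists E : R, exists K : op R d q n,
  [/\ H *m v = (E%:C)%C *: v, expv v H = (E%:C)%C & H - ((E%:C)%C)%:M = adjmx K *m K].
Proof.
have [v1 [E [HvE Emin]]] := vH; have [K HK] := ground_psd hH Emin.
have EvH : expv v H = E by rewrite /expv -mulmxA HvE -scalemxAr v1 !mxE mulr1.
have Ereal : E \is Num.real by apply/CrealP; rewrite -EvH -expv_adj hH.
by exists (complex.Re E), K; rewrite (RRe_real Ereal).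
Qed.

(** Variational principle against arbitrary states, not only vector states: the trial states used
    later are restrictions from larger boxes or from infinite volume. *)
Lemma ground_le (r : op R d q n -> R) : rstate r -> complex.Re (expv v H) <= r H.
Proof.
move=> rP; have [E [K [_ -> HK]]] := ground_sqrt; rewrite /=.
have := rstate_ge0 rP K; rewrite -HK (rstateB rP) -scalemx1 (rstateZ rP) (rstate1 rP).
by rewrite mulr1 subr_ge0.
Qed.

(** As [v] is an eigenvector, the expectation equals that of A^* (H - E) A, which is the squared
    norm of K A v. *)
Lemma ground_comm_ge0 (A : op R d q n) : 0 <= expv v (adjmx A *m comm_mx2 H A).
Proof.
have [E [K [HvE _ HK]]] := ground_sqrt.
suff -> : expv v (adjmx A *m comm_mx2 H A) = expv v (adjmx (K *m A) *m (K *m A)).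
  exact: expv_ge0.
rewrite adjmxM -[in RHS]mulmxA [in X in _ = expv v (adjmx A *m X)]mulmxA -HK.
rewrite mulmxBl mul_scalar_mx.
rewrite /comm_mx2 mulmxBr [in RHS]mulmxBr.
apply: (etrans (expvB v _ _)); apply: (etrans _ (esym (expvB v _ _))).
apply: (congr1 (fun z => _ - z)).
rewrite -scalemxAr expvZ /expv -!mulmxA HvE -!scalemxAr.
by rewrite [in LHS]mxE.
Qed.

End Ground.

(** * States of the quasi-local algebra and their local energies *)

Section States.
Variables (R : realType) (d q : nat).
Local Notation C := R[i].
Variables S1 S2 S3 : 'M[C]_q.
Variable w : forall n, op R d q n -> C.
Hypothesis wS : is_state w.

Lemma state_rstate n : rstate (fun a : op R d q n => complex.Re (w a)).
Proof. by have [wL [wp [w1 _]]] := wS; apply: rstate_state. Qed.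

Lemma state_embed n L (a : op R d q n) : (n <= L)%N -> w (embed_op L a) = w a.
Proof.
have [_ [_ [_ wE]]] := wS; elim: L => [|L IH].
  by rewrite leqn0 => /eqP n0; subst n; rewrite embed_id.
rewrite leq_eqVlt => /predU1P[nL|nL]; first by subst n; rewrite embed_id.
by rewrite -(embed_comp a nL (leqnSn L)) wE IH.
Qed.

Lemma state0 n : w (0 : op R d q n) = 0.
Proof. by have [wL _] := wS; have := wL n (-1) 0 0; rewrite scaler0 addr0 mulN1r addNr. Qed.

Lemma stateZ n c (a : op R d q n) : w (c *: a) = c * w a.
Proof. by have [wL _] := wS; have := wL n c a 0; rewrite addr0 state0 addr0. Qed.

Lemma cvgC_const (u : nat -> C) (c l : C) N :
  (forall k, (N <= k)%N -> u k = c) -> cvgC u l -> l = c.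
Proof.
move=> uc ul; apply/eqP/negPn/negP => lc.
have p : 0 < `|c - l| by rewrite normr_gt0 subr_eq0 eq_sym.
have e : ((complex.Re `|c - l|)%:C)%C = `|c - l| by apply: RRe_real; exact: ger0_real (ltW p).
have e0 : 0 < complex.Re `|c - l| by move: p; rewrite -e ltcR.
have [N' /(_ (maxn N N') (leq_maxr _ _))] := ul _ e0.
by rewrite uc ?leq_maxl// e ltxx.
Qed.

(** The sequence whose limit defines a ground state is thus constant as soon as the box strictly
    contains that of [a]. *)
Lemma comm_H0_state n0 n (a : op R d q n0) : (n0 < n)%N ->
  let A := embed_op n a in let a1 := embed_op n0.+1 a in
  w (adjmx A *m comm_mx2 (H0 d S1 S2 S3 n) A) =
  w (adjmx a1 *m comm_mx2 (H0 d S1 S2 S3 n0.+1) a1).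
Proof.
move=> n0n A a1; rewrite /A (comm_H0_local S1 S2 S3 a (ltnSn n0) n0n).
rewrite -(embed_comp a (leqnSn n0) n0n) -embed_adj -(embedM _ _ n0n).
exact: state_embed.
Qed.

(** Composition of a state with a unital completely positive map in Kraus form. *)
Lemma rstate_sum_conj n (r : op R d q n -> R) (I : finType) (F : I -> op R d q n) :
  rstate r -> \sum_i adjmx (F i) *m F i = 1%:M ->
  rstate (fun X => \sum_i r (adjmx (F i) *m X *m F i)).
Proof.
move=> rP F1; split=> [a b|c a|a|].
- by rewrite -big_split; apply: eq_bigr => i _; rewrite mulmxDr mulmxDl (rstateD rP).
- by rewrite mulr_sumr; apply: eq_bigr => i _; rewrite -scalemxAr -scalemxAl (rstateZ rP).
- apply: sumr_ge0 => i _.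
  have -> : adjmx (F i) *m (adjmx a *m a) *m F i = adjmx (a *m F i) *m (a *m F i).
    by rewrite adjmxM !mulmxA.
  exact: (rstate_ge0 rP).
- under eq_bigr do rewrite mulmx1.
  by rewrite -(rstate_sum rP) F1 (rstate1 rP).
Qed.

End States.

Section GroundStateEnergy.
Variables (R : realType) (d q : nat).
Local Notation C := R[i].
Variables S1 S2 S3 : 'M[C]_q.
Hypothesis herm : adjmx S1 = S1 /\ adjmx S2 = S2 /\ adjmx S3 = S3.
Variable s : R.
Hypothesis casimir : S1 *m S1 + S2 *m S2 + S3 *m S3 = ((s%:C)%C)%:M.
Variable w : forall n, op R d q n -> C.
Hypothesis wG : is_ground_state S1 S2 S3 w.

Lemma ground_state_comm_ge0 n (a : op R d q n) :
  let a1 := embed_op n.+1 a in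
  0 <= w (adjmx a1 *m comm_mx2 (H0 d S1 S2 S3 n.+1) a1).
Proof.
have [wS wg] := wG; have [l [l0 wl]] := wg n a.
have E : l = w (adjmx (embed_op n.+1 a) *m
    comm_mx2 (H0 d S1 S2 S3 n.+1) (embed_op n.+1 a)).
  by apply: (@cvgC_const R _ _ _ n.+1 _ wl) => k nk; exact: comm_H0_state.
by move: l0; rewrite E.
Qed.

(* Summing the local stability inequality over the matrix units
   [v *m delta_mx ord0 j] replaces the restriction of the state to the box by
   the vector state of [v] and leaves it unchanged outside. *)
Lemma ground_state_energy n (v : vec R d q n.+1) : adjmx v *m v = 1 ->
  complex.Re (w (H0 d S1 S2 S3 n.+1)) <= complex.Re (expv v (H0 d S1 S2 S3 n.+1)) +
    2 * (d.*2%:R * s * (vol d n.+2 - vol d n)%N%:R).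
Proof.
move=> v1; have [wS _] := wG.
pose a (j : 'I_(Defs.dim d q n.+1)) : op R d q n.+1 := v *m delta_mx ord0 j.
have aba b i : adjmx (a i) *m b *m a i = expv v b *: delta_mx i i.
  rewrite /a adjmxM.
  have -> : adjmx (delta_mx ord0 i : 'rV[C]_(Defs.dim d q n.+1)) = delta_mx i ord0.
    by apply/matrixP => k l; rewrite !mxE rmorph_nat andbC.
  rewrite -!mulmxA [X in _ *m X]mulmxA [X in _ *m X]mulmxA.
  have -> : adjmx v *m b *m v = (expv v b)%:M by apply: mx11_scalar.
  by rewrite mul_scalar_mx -scalemxAr mul_delta_mx.
have sum_delta : \sum_i delta_mx i i = 1%:M :> op R d q n.+1.
  by rewrite -[RHS]diag_const_mx [RHS]diag_mx_sum_delta; apply: eq_bigr => i _; rewrite mxE scale1r.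
pose F i := embed_op n.+2 (a i).
have nn := leqnSn n.+1.
have Faba b : \sum_i adjmx (F i) *m embed_op n.+2 b *m F i = expv v b *: 1%:M.
  rewrite -(embed1 R d q nn) -sum_delta -embedZ scaler_sumr embed_sum.
  by apply: eq_bigr => i _; rewrite /F -embed_adj -!(embedM _ _ nn) aba.
have F1 : \sum_i adjmx (F i) *m F i = 1%:M.
  have := Faba 1%:M; rewrite (embed1 _ _ _ nn) expv1// scale1r => <-.
  by apply: eq_bigr => i _; rewrite mulmx1.
pose r (X : op R d q n.+2) := complex.Re (w X).
have rP : rstate r by exact: state_rstate.
pose r' X := \sum_i r (adjmx (F i) *m X *m F i).
have rP' : rstate r' by exact: rstate_sum_conj.
(* Because the F_i^* F_i sum to 1, the stability inequalities for the [a i], read in box [n.+2], add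
   up to this comparison. *)
have le_rr' : r (H0 d S1 S2 S3 n.+2) <= r' (H0 d S1 S2 S3 n.+2).
  rewrite -subr_ge0 -[X in _ - r X]mul1mx -F1 mulmx_suml (rstate_sum rP) -sumrB.
  apply: sumr_ge0 => i _; rewrite -(rstateB rP).
  have := Re_ge0 (ground_state_comm_ge0 (a i)).
  by rewrite /= /comm_mx2 mulmxBr !mulmxA.
have r'E : r' (embed_op n.+2 (H0 d S1 S2 S3 n.+1)) = complex.Re (expv v (H0 d S1 S2 S3 n.+1)).
  rewrite /r' -(rstate_sum rP) Faba /r (stateZ wS).
  by have [_ [_ [w1 _]]] := wS; rewrite -/(1 : op R d q n.+2) w1 mulr1.
(* The boxes [n.+1] and [n.+2] are compared both before and after the replacement, whence the factor
   2. *)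
have A := H0_succ_approx herm casimir rP; have B := H0_succ_approx herm casimir rP'.
have rE : r (embed_op n.+2 (H0 d S1 S2 S3 n.+1)) = complex.Re (w (H0 d S1 S2 S3 n.+1)).
  by rewrite /r (state_embed wS).
rewrite r'E in B; rewrite rE in A; move: A B le_rr'.
move: (r (H0 d S1 S2 S3 n.+2)) (r' (H0 d S1 S2 S3 n.+2)) => x y.
move: (complex.Re (w _)) (complex.Re (expv v _)) (_ * _%:R) => z t K.
by rewrite !ler_norml => /andP[? ?] /andP[? ?] ?; lra.
Qed.

End GroundStateEnergy.

(** * Period two of the local expectations *)

Section Periodicity.
Variables (R : realType) (d q : nat).
Local Notation C := R[i].
Local Notation coord := Defs.coord.

(** Parity flips at the wrap-around too, because the side length is even. *)
Lemma odd_ordS n (k : 'I_(n.+1).*2) : odd (ordS k) = ~~ odd k.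
Proof.
have e : (ordS k : nat) = (k.+1 %% (n.+1).*2)%N by [].
have o2 m : odd m = (m %% 2 == 1)%N :> bool by rewrite modn2 eqb1.
rewrite e o2 modn_dvdm; last by rewrite -muln2 dvdn_mull.
by rewrite -o2.
Qed.

Lemma expN1_coord n (x : site d n) i : (-1 : R) ^ coord x i = (-1) ^+ (x i + n).
Proof.
rewrite /Defs.coord expfzDr ?oppr_eq0 ?oner_eq0// exprD; congr (_ * _).
by rewrite -exprnN invr_sign.
Qed.

Lemma sgs_prod n (x : site d n) : sgs R x = \prod_i (-1) ^+ (x i + n).
Proof.
rewrite /sgs; under [RHS]eq_bigr do rewrite -expN1_coord.
apply: (big_morph (fun k : int => (-1 : R) ^ k)) => // a b.
by rewrite expfzDr// oppr_eq0 oner_eq0.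
Qed.

Lemma sgs_shift2 n : shift2_inv (@sgs R d n).
Proof.
move=> i x; rewrite !sgs_prod; apply: eq_bigr => j _; rewrite ffunE.
by case: ifP => // _; rewrite -signr_odd -[RHS]signr_odd !oddD !odd_ordS negbK.
Qed.

Lemma adj_shift2 n i (x y : site d n) : adj (shift2 i x) (shift2 i y) = adj x y.
Proof.
have oI m : injective (@ordS m) := can_inj (@ordSK m).
rewrite /adj (bij_eq (shift2_bij n i)); congr (_ && _); apply: eq_existsb => j.
rewrite !ffunE; congr (_ && _).
  by apply: eq_forallb => k; rewrite !ffunE; case: ifP => // _; rewrite !(inj_eq (oI _)).
by case: ifP => // _; rewrite !(inj_eq (oI _)).
Qed.

Variables (n : nat) (v : vec R d q n).
Hypothesis vT : trans2_inv v.
Variables S1 S2 S3 : 'M[C]_q.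

Lemma onsite_shift2_inv (A : 'M[C]_q) :
  shift2_inv (fun x : site d n => complex.Re (expv v (onsite x A))).
Proof.
by move=> i x; rewrite (expv_shift2 vT (kof_onsite_shift2 x A i)).
Qed.

Lemma bond_additive (r : op R d q n -> R) (rD : forall a b, r (a + b) = r a + r b) x y :
  r (bond S1 S2 S3 x y) = r (onsite x S1 *m onsite y S1) +
    r (onsite x S2 *m onsite y S2) + r (onsite x S3 *m onsite y S3).
Proof. by rewrite /bond !rD. Qed.

Lemma Re_expv_bond x y : complex.Re (expv v (bond S1 S2 S3 x y)) =
  complex.Re (expv v (onsite x S1 *m onsite y S1)) +
  complex.Re (expv v (onsite x S2 *m onsite y S2)) +
  complex.Re (expv v (onsite x S3 *m onsite y S3)).
Proof.
apply: (@bond_additive (fun a => complex.Re (expv v a))) => a b.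
by rewrite expvD ReD.
Qed.

Lemma nbr_shift2_inv : shift2_inv (nbr S1 S2 S3 (fun a : op R d q n => complex.Re (expv v a))).
Proof.
move=> i x.
apply: (etrans (reindex (@shift2 d n i) (onW_bij _ (shift2_bij n i)))).
apply: eq_big => [y|y _]; first exact: adj_shift2.
have rE (A B : 'M[C]_q) :
    complex.Re (expv v (onsite (shift2 i x) A *m onsite (shift2 i y) B)) =
    complex.Re (expv v (onsite x A *m onsite y B)).
  by rewrite (expv_shift2 vT (kof_onsite2_shift2 x y A B i)).
have E3 := congr2 +%R (congr2 +%R (rE S1 S1) (rE S2 S2)) (rE S3 S3).
exact: (etrans (Re_expv_bond _ _) (etrans E3 (esym (Re_expv_bond _ _)))).
Qed.

End Periodicity.

(** * Self-adjointness, bounds per site, and restriction of periodic vectors *)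

Section SelfAdjoint.
Variables (R : realType) (d q : nat).
Local Notation C := R[i].
Variables S1 S2 S3 : 'M[C]_q.
Hypothesis herm : adjmx S1 = S1 /\ adjmx S2 = S2 /\ adjmx S3 = S3.

Lemma conj_realC (c : R) : ((c%:C)%C : C)^* = (c%:C)%C.
Proof. by apply/eqP; rewrite eq_complex /= oppr0 !eqxx. Qed.

Lemma H0_adj n : adjmx (H0 d S1 S2 S3 n) = H0 d S1 S2 S3 n.
Proof.
have [h1 [h2 h3]] := herm.
rewrite H0E adjmxZ conj_realC adjmx_sum; congr (_ *: _); apply: eq_bigr => x _.
rewrite adjmx_sum; apply: eq_bigr => y xy; rewrite [RHS](bond_sym _ _ _ xy) /bond.
have hA (A : 'M[C]_q) : adjmx A = A ->
    adjmx (onsite x A *m onsite y A) = onsite y A *m onsite x A.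
  by move=> AA; rewrite adjmxM -(onsite_adj y A) -(onsite_adj x A) AA.
by rewrite adjmxD [X in X + _]adjmxD (hA _ h1) (hA _ h2) (hA _ h3).
Qed.

Lemma stag_adj n : adjmx (stag d S3 n) = stag d S3 n.
Proof.
have [h1 [h2 h3]] := herm.
rewrite stagE adjmx_sum; apply: eq_bigr => x _.
by rewrite adjmxZ conj_realC -onsite_adj h3.
Qed.

Lemma Hp_adj n B : adjmx (Hp d S1 S2 S3 n B) = Hp d S1 S2 S3 n B.
Proof. by rewrite /Hp adjmxB adjmxZ conj_realC H0_adj stag_adj. Qed.

Lemma rstate_Hp n B (r : op R d q n -> R) : rstate r ->
  r (Hp d S1 S2 S3 n B) = r (H0 d S1 S2 S3 n) - B * r (stag d S3 n).
Proof. by move=> rP; rewrite /Hp (rstateB rP) (rstateZ rP). Qed.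

Variable s : R.
Hypothesis casimir : S1 *m S1 + S2 *m S2 + S3 *m S3 = ((s%:C)%C)%:M.

Lemma rstate_stag_le n (r : op R d q n -> R) : rstate r ->
  `|r (stag d S3 n)| <= (vol d n)%:R * ((1 + s) / 2).
Proof.
move=> rP; rewrite (rstate_stag S3 rP); apply: le_trans (ler_norm_sum _ _ _) _.
rewrite -(card_site d n) mulr_natl -sumr_const; apply: ler_sum => x _.
by rewrite normrM norm_sgs mul1r; exact: (rstate_onsite herm casimir).
Qed.

Lemma rstate_H0_le n (r : op R d q n -> R) : rstate r ->
  `|r (H0 d S1 S2 S3 n)| <= (vol d n)%:R * (d.*2%:R * s).
Proof.
move=> rP; rewrite (rstate_H0 S1 S2 S3 rP) normrM ger0_norm ?invr_ge0// ler_pdivrMl//.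
apply: le_trans (ler_norm_sum _ _ _) _.
apply: (@le_trans _ _ ((vol d n)%:R * (d.*2%:R * s))).
  rewrite -(card_site d n) mulr_natl -sumr_const; apply: ler_sum => x _.
  exact: (nbr_bound herm casimir).
have [x _|e] := pickP (fun x : site d n => true); last first.
  by have := card_site d n; rewrite eq_card0// => <-; rewrite !mul0r mulr0.
rewrite ler_peMl ?ler1n// mulr_ge0// mulr_ge0//.
exact: (casimir_ge0 herm casimir x rP).
Qed.

(** Arithmetic of [Hp_embed]: the field terms per site cancel exactly and only the exchange part
    leaves a boundary error. *)
Lemma avg_le_arith (a a0 a1 b b0 b1 sa sb va vb x c k : R) : 0 < va ->
  a = a0 - x * a1 -> b = b0 - x * b1 -> a1 / va = b1 / vb ->
  `|a0 - 2^-1 * sa| <= c * k -> sa / va = sb / vb -> b0 = 2^-1 * sb ->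
  a / va <= b / vb + c * (k / va).
Proof.
move=> va0 -> -> a1b1 /ler_normlP[_ a0_le] sab ->.
rewrite !mulrBl -!(mulrA x) a1b1 addrAC lerD2r -mulrA -sab !mulrA -mulrDl.
by rewrite ler_pM2r ?invr_gt0// -lerBlDl.
Qed.

Section PeriodicVector.
Variables (L : nat) (v : vec R d q L) (B : R).
Hypothesis v1 : adjmx v *m v = 1.
Hypothesis vT : trans2_inv v.
Let r (a : op R d q L) := complex.Re (expv v a).

(** Exact at finite volume: the staggered sign and the one-site expectations both have period
    two. *)
Lemma stag_embed n : (n <= L)%N ->
  r (embed_op L (stag d S3 n)) / (vol d n)%:R = r (stag d S3 L) / (vol d L)%:R.
Proof.
move=> nL; have rP : rstate r by exact: rstate_expv.
rewrite (rstate_stag S3 rP) (rstate_stag S3 (rstate_embed nL rP)).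
rewrite -(avg_shift2_inv nL); last first.
  by move=> i x; congr (_ * _); [exact: sgs_shift2|exact: onsite_shift2_inv].
apply: (congr1 (fun z => z / _)); apply: eq_bigr => x _.
by rewrite (sgs_iota R x nL) (embed_onsite x S3 nL).
Qed.

Lemma Hp_embed n : (n < L)%N ->
  r (embed_op L (Hp d S1 S2 S3 n.+1 B)) / (vol d n.+1)%:R <=
  r (Hp d S1 S2 S3 L B) / (vol d L)%:R +
  d.*2%:R * s * ((vol d n.+1 - vol d n)%N%:R / (vol d n.+1)%:R).
Proof.
move=> nL; have rP : rstate r by exact: rstate_expv.
have v0 : 0 < (vol d n.+1)%:R :> R by rewrite ltr0n vol_gt0.
exact: (avg_le_arith v0 (rstate_Hp B (rstate_embed nL rP)) (rstate_Hp B rP)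
  (stag_embed nL) (embed_H0_approx herm casimir nL rP)
  (avg_shift2_inv nL (nbr_shift2_inv vT S1 S2 S3)) (rstate_H0 S1 S2 S3 rP)).
Qed.

End PeriodicVector.

End SelfAdjoint.

(** * Real limits *)

Section Limits.
Variable R : realType.

(** Compactness of the segment gives a cluster point, and a cluster point of an ultrafilter is a
    limit. *)
Lemma ultra_cvg (T : Type) (U : set_system T) (u : T -> R) (M : R) :
  UltraFilter U -> U [set k | `|u k| <= M] -> exists l : R, u @ U --> l.
Proof.
move=> UU uM.
have uU : U (u @^-1` `[- M, M]).
  by apply: filterS uM => k; rewrite /= in_itv /= ler_norml.
have [l [_ cl]] := @segment_compact R (- M) M (u @ U) _ uU.
exists l => A lA; have [//|nA] := in_ultra_setVsetC (u @^-1` A) UU.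
by have [x []] := cl (~` A) A nA lA.
Qed.

(** The limit is the supremum of the numbers [a n.+1 - e n]: each of them bounds all later terms
    from below, and [a n.+1] exceeds the supremum by at most [e n]. *)
Lemma almost_monotone_cvg (a e : nat -> R) (M : R) : (forall n, `|a n| <= M) ->
  e @ \oo --> 0 -> (forall n L, (n < L)%N -> a n.+1 <= a L + e n) ->
  exists l : R, a @ \oo --> l.
Proof.
move=> aM e0 ae.
pose A := [set a n.+1 - e n | n in [set: nat]].
have eM n : a n.+1 - e n <= M.
  by rewrite lerBlDr; apply: le_trans (ae _ _ (ltnSn n)) _; rewrite lerD2r ler_normlW.
have A_sup : has_sup A.
  by split; [exists (a 1%N - e 0%N); exists 0%N | exists M => _ [n _ <-]].
exists (sup A); apply/cvgrPdist_le => eps eps0.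
have [_ [m _ <-] mA] := sup_adherent eps0 A_sup.
have e_small := cvgr_dist_le e 0 e0 _ eps0.
apply/near_inftyS; near=> n.
rewrite ler_norml; apply/andP; split; last first.
  have /(ae m) : (m < n.+1)%N by rewrite ltnS; near: n; exact: nbhs_infty_ge.
  by rewrite -lerBlDr; lra.
have : a n.+1 - e n <= sup A by apply: sup_upper_bound => //; exists n.
have : `|0 - e n| <= eps by near: n; exact: e_small.
by rewrite ler_norml; lra.
Unshelve. all: by end_near. Qed.

(** Boundedness is what identifies the real-valued [limn_sup] with the infimum of the suprema of the
    tails. *)
Lemma limn_sup_le (u : nat -> R) (l M : R) : (forall n, `|u n| <= M) ->
  (forall eps, 0 < eps -> \forall n \near \oo, u n <= l + eps) -> limn_sup u <= l.
Proof.
move=> uM ul.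
have bu : bounded_fun u.
  by exists M; split; [exact: num_real|move=> y My x _; exact: le_trans (uM x) (ltW My)].
rewrite (limn_supE bu); apply/ler_addgt0Pr => eps eps0.
have [N _ NP] := ul _ eps0.
apply: (@le_trans _ _ (sups u N)).
  by apply: ge_inf; [exact: bounded_fun_has_lbound_sups|exists N].
apply: ge_sup; first by exists (u N); exists N => //=.
by move=> _ [k /= Nk <-]; exact: NP.
Qed.

(** With h = 1/(n+2) the ratio is (1 + h)^d - (1 - h)^d, since the three sides are 2(n+1), 2(n+2)
    and 2(n+3). *)
Lemma vol_ratio d : (fun n => (vol d n.+2 - vol d n)%N%:R / (vol d n.+1)%:R : R) @ \oo --> 0.
Proof.
have h0 : (fun n => @harmonic R n.+1) @ \oo --> 0.
  have : [sequence @harmonic R n.+1]_n @ \oo --> 0; last by [].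
  by rewrite cvg_shiftS; exact: cvg_harmonic.
have -> : (fun n => (vol d n.+2 - vol d n)%N%:R / (vol d n.+1)%:R : R) =
    (fun n => (1 + harmonic n.+1) ^+ d - (1 - harmonic n.+1) ^+ d).
  apply/funext => n; rewrite natrB; last by apply: vol_le; lia.
  rewrite mulrBl /vol !natrX -!expr_div_n.
  have n0 : n.+2%:R != 0 :> R by rewrite pnatr_eq0.
  rewrite -!mul2n !natrM; congr (_ ^+ _ - _ ^+ _); rewrite /harmonic /=.
    by rewrite -[n.+3]addn1 natrD; field.
  have -> : n.+1%:R = n.+2%:R - 1 :> R by rewrite -[n.+2]addn1 natrD addrK.
  by field.
have h1 : (fun n => 1 + @harmonic R n.+1) @ \oo --> (1 : R).
  by have := cvgD (@cvg_cst _ (1 : R) _ \oo _) h0; rewrite addr0; apply.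
have h2 : (fun n => 1 - @harmonic R n.+1) @ \oo --> (1 : R).
  by have := cvgB (@cvg_cst _ (1 : R) _ \oo _) h0; rewrite subr0; apply.
have := cvgB (cvg_comp _ _ h1 (@exprn_continuous R d 1))
             (cvg_comp _ _ h2 (@exprn_continuous R d 1)).
by rewrite subrr; apply.
Qed.

End Limits.

Lemma slope_le (R : realFieldType) (e e' m p : R) :
  e' <= e - p * m -> m * p <= e - e'.
Proof. by lra. Qed.

(** * Thermodynamic limit *)

Section FiniteVolume.
Variables (R : realType) (d q : nat).
Local Notation C := R[i].
Variables S1 S2 S3 : 'M[C]_q.
Hypothesis herm : adjmx S1 = S1 /\ adjmx S2 = S2 /\ adjmx S3 = S3.
Variable s : R.
Hypothesis casimir : S1 *m S1 + S2 *m S2 + S3 *m S3 = ((s%:C)%C)%:M.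
Variable Phi0 : forall n : nat, R -> vec R d q n.
Hypothesis hPhi0 : forall n (B : R), 0 < B ->
  ground_vec (Hp d S1 S2 S3 n B) (Phi0 n B) /\ trans2_inv (Phi0 n B).

Definition energy n B : R :=
  complex.Re (expv (Phi0 n B) (Hp d S1 S2 S3 n B)) / (vol d n)%:R.
Definition magn n B : R :=
  complex.Re (expv (Phi0 n B) (stag d S3 n)) / (vol d n)%:R.

Lemma volR_gt0 n : 0 < (vol d n)%:R :> R.
Proof. by rewrite ltr0n vol_gt0. Qed.

Lemma norm_div_vol n (x c : R) :
  `|x| <= (vol d n)%:R * c -> `|x / (vol d n)%:R| <= c.
Proof.
move=> xc; rewrite normrM normfV (ger0_norm (ltW (volR_gt0 n))).
by rewrite (ler_pdivrMr _ _ (volR_gt0 n)) [leRHS]mulrC.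
Qed.

Lemma Phi0_rstate n B : 0 < B -> rstate (fun a => complex.Re (expv (Phi0 n B) a)).
Proof. by move=> /(hPhi0 n)[[v1 _] _]; exact: rstate_expv. Qed.

Lemma Phi0_min n B (r : op R d q n -> R) : 0 < B -> rstate r ->
  complex.Re (expv (Phi0 n B) (Hp d S1 S2 S3 n B)) <=
  r (H0 d S1 S2 S3 n) - B * r (stag d S3 n).
Proof.
move=> /(hPhi0 n)[vH _] rP.
have E := rstate_Hp S1 S2 S3 B rP.
by rewrite -E; exact: (ground_le (Hp_adj d herm n B) vH rP).
Qed.

Lemma energyE n B : 0 < B -> energy n B =
  complex.Re (expv (Phi0 n B) (H0 d S1 S2 S3 n)) / (vol d n)%:R - B * magn n B.
Proof.
move=> B0; have := rstate_Hp S1 S2 S3 B (Phi0_rstate n B0) => E.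
by rewrite /energy /magn mulrA -mulrBl; apply: (congr1 (fun z => z / _)).
Qed.

(** The ground vector at [B] serves as a trial state at [B']; this makes [- magn n B] a
    supergradient. *)
Lemma energy_concave n B B' : 0 < B -> 0 < B' ->
  energy n B' <= energy n B - (B' - B) * magn n B.
Proof.
move=> B0 B'0; rewrite (energyE n B0) /magn.
have := Phi0_min B'0 (Phi0_rstate n B0).
rewrite -(@ler_pM2r _ ((vol d n)%:R^-1)) ?invr_gt0 ?volR_gt0// => /le_trans; apply.
by rewrite le_eqVlt; apply/orP; left; apply/eqP; ring.
Qed.

Lemma magn_le n B : 0 < B -> `|magn n B| <= (1 + s) / 2.
Proof.
move=> B0; apply: norm_div_vol.
exact: (rstate_stag_le herm casimir (Phi0_rstate n B0)).
Qed.

Lemma energy_le n B : 0 < B -> `|energy n B| <= d.*2%:R * s + B * ((1 + s) / 2).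
Proof.
move=> B0; rewrite (energyE n B0); apply: le_trans (ler_normB _ _) _.
apply: lerD; last first.
  by rewrite normrM (gtr0_norm B0); exact: ler_wpM2l (ltW B0) _ _ (magn_le n B0).
apply: norm_div_vol.
exact: (rstate_H0_le herm casimir (Phi0_rstate n B0)).
Qed.

Lemma s_ge0 : 0 <= s.
Proof.
pose x : site d 0 := [ffun=> ord0].
exact: (casimir_ge0 herm casimir x (Phi0_rstate 0 ltr01)).
Qed.

(* The ground state of a large box restricted to a small one is a trial state
   there; this half of the usual subadditivity argument already forces convergence. *)
Lemma energy_almost_monotone n L B : 0 < B -> (n < L)%N ->
  energy n.+1 B <= energy L B +
    d.*2%:R * s * ((vol d n.+2 - vol d n)%N%:R / (vol d n.+1)%:R).
Proof.
move=> B0 nL; have [[v1 _] vT] := hPhi0 L B0.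
apply: le_trans (le_trans (Hp_embed herm casimir B v1 vT nL) _).
  rewrite ler_pM2r ?invr_gt0 ?volR_gt0//.
  have [vH _] := hPhi0 n.+1 B0.
  exact: (ground_le (Hp_adj d herm n.+1 B) vH (rstate_embed nL (Phi0_rstate L B0))).
rewrite lerD2l ler_wpM2l ?mulr_ge0 ?s_ge0// ler_pM2r ?invr_gt0 ?volR_gt0//.
by rewrite ler_nat leq_sub2r// vol_le.
Qed.

Lemma energy_cvg B : 0 < B -> exists e : R, energy^~ B @ \oo --> e.
Proof.
move=> B0; apply: (almost_monotone_cvg (fun n => energy_le n B0)); last first.
  by move=> n L; exact: energy_almost_monotone.
by have := cvgM (@cvg_cst _ (d.*2%:R * s : R) _ \oo _) (@vol_ratio R d); rewrite mulr0; apply.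
Qed.

Lemma ground_state_magn n B (w : forall n, op R d q n -> C) : 0 < B ->
  is_ground_state S1 S2 S3 w ->
  complex.Re (w n.+1 (stag d S3 n.+1)) / (vol d n.+1)%:R <= magn n.+1 B +
    2 * (d.*2%:R * s) / B * ((vol d n.+2 - vol d n)%N%:R / (vol d n.+1)%:R).
Proof.
move=> B0 wG; have [[v1 _] _] := hPhi0 n.+1 B0.
have A := Phi0_min B0 (state_rstate wG.1 n.+1).
have D := ground_state_energy herm casimir wG v1.
have := rstate_Hp S1 S2 S3 B (Phi0_rstate n.+1 B0) => E.
rewrite /magn -(ler_pM2r (volR_gt0 n.+1)) -(ler_pM2l B0).
have v0 := lt0r_neq0 (volR_gt0 n.+1).
rewrite [leLHS]mulrC divfK//.
have -> : B * ((complex.Re (expv (Phi0 n.+1 B) (stag d S3 n.+1)) / (vol d n.+1)%:R +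
    2 * (d.*2%:R * s) / B * ((vol d n.+2 - vol d n)%N%:R / (vol d n.+1)%:R)) *
    (vol d n.+1)%:R) = B * complex.Re (expv (Phi0 n.+1 B) (stag d S3 n.+1)) +
    2 * (d.*2%:R * s * (vol d n.+2 - vol d n)%N%:R).
  by field; rewrite v0 (lt0r_neq0 B0).
move: A; rewrite E mulrC; lra.
Qed.

Lemma Phi0_stag_embed n L B : 0 < B -> (n <= L)%N ->
  complex.Re (expv (Phi0 L B) (embed_op L (stag d S3 n))) = magn L B * (vol d n)%:R.
Proof.
move=> B0 nL; have [[v1 _] vT] := hPhi0 L B0.
rewrite /magn -(stag_embed S3 v1 vT nL) divfK//.
exact: lt0r_neq0 (volR_gt0 n).
Qed.

Section Thermodynamic.
Variable Lseq : R -> nat -> nat.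
Hypothesis hLseq : forall B : R, 0 < B ->
  (forall k, (Lseq B k < Lseq B k.+1)%N) /\
  (forall n0 (a : op R d q n0), exists l,
    cvgC (fun k => expv (Phi0 (Lseq B k) B) (embed_op (Lseq B k) a)) l).

Lemma Lseq_ge B k : 0 < B -> (k <= Lseq B k)%N.
Proof.
move=> /hLseq[incr _]; elim: k => // k IH; exact: leq_ltn_trans IH (incr k).
Qed.

Lemma Lseq_cvg B : 0 < B -> Lseq B @ \oo --> \oo.
Proof.
move=> B0 A [N _ NA]; exists N => // k /= Nk; apply: NA.
exact: leq_trans Nk (Lseq_ge k B0).
Qed.

Lemma ReB (y z : C) : complex.Re (y - z) = complex.Re y - complex.Re z.
Proof. by case: y z => a b [a' b']. Qed.

Lemma cvgC_Re (u : nat -> C) (l : C) : cvgC u l ->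
  (fun k => complex.Re (u k)) @ \oo --> complex.Re l.
Proof.
move=> ul; apply/cvgrPdist_lt => e e0; have [N NP] := ul e e0.
exists N => // k /= /NP H; rewrite distrC -ltcR; apply: le_lt_trans H.
have -> : complex.Re (u k) - complex.Re l = complex.Re (u k - l).
  exact/esym/ReB.
exact: normc_ge_Re.
Qed.

(** The observable O/|Λ| changes with the box, so convergence on local operators does not apply to
    it directly. By period two its expectation equals that of the fixed local observable on the box
    of side 2. *)
Lemma magn_cvg B : 0 < B -> exists m : R, (fun k => magn (Lseq B k) B) @ \oo --> m.
Proof.
move=> B0; have [_ /(_ 0%N (stag d S3 0))[l /cvgC_Re lP]] := hLseq B0.
exists (complex.Re l / (vol d 0)%:R).
have -> : (fun k => magn (Lseq B k) B) = (fun k => complex.Re (expv (Phi0 (Lseq B k) B)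
    (embed_op (Lseq B k) (stag d S3 0))) / (vol d 0)%:R).
  apply/funext => k; rewrite (Phi0_stag_embed B0 (leq0n _)) mulfK//.
  exact: lt0r_neq0 (volR_gt0 0).
by apply: cvgM lP _; exact: cvg_cst.
Qed.

Definition magn_lim B : R := limn (fun k => magn (Lseq B k) B).
Definition energy_lim B : R := limn (energy^~ B).

Lemma magn_limP B : 0 < B -> (fun k => magn (Lseq B k) B) @ \oo --> magn_lim B.
Proof. by move=> /magn_cvg[m mP]; rewrite /magn_lim (cvg_lim _ mP). Qed.

Lemma energy_limP B : 0 < B -> energy^~ B @ \oo --> energy_lim B.
Proof. by move=> /energy_cvg[m mP]; rewrite /energy_lim (cvg_lim _ mP). Qed.

(** The limit is taken along [Lseq B], where the magnetization at [B] converges; the energy at [B']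
    converges there as well because it does so along all boxes. *)
Lemma energy_lim_concave B B' : 0 < B -> 0 < B' -> energy_lim B' <= energy_lim B - (B' - B) * magn_lim B.
Proof.
move=> B0 B'0.
have c1 := cvg_comp _ _ (Lseq_cvg B0) (energy_limP B'0).
have c2 := cvg_comp _ _ (Lseq_cvg B0) (energy_limP B0).
have c3 := cvgB c2 (cvgM (@cvg_cst _ (B' - B : R) _ \oo _) (magn_limP B0)).
apply: (@ler_cvg_to _ \oo _ R (fun k => energy (Lseq B k) B')
  (fun k => energy (Lseq B k) B - (B' - B) * magn (Lseq B k) B)); [exact: c1|exact: c3|].
by apply: nearW => k; exact: energy_concave.
Qed.

(** Adding the supergradient inequalities at the two fields eliminates the energies. *)
Lemma magn_lim_le B B' : 0 < B -> B <= B' -> magn_lim B <= magn_lim B'.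
Proof.
move=> B0; rewrite le_eqVlt => /predU1P[->//|BB'].
have B'0 := lt_trans B0 BB'.
have p : 0 < B' - B by rewrite subr_gt0.
suff H : (B' - B) * magn_lim B <= (B' - B) * magn_lim B' by move: H; rewrite (ler_pM2l p).
have := energy_lim_concave B0 B'0; have := energy_lim_concave B'0 B0.
move: (energy_lim B) (energy_lim B') (magn_lim B) (magn_lim B') => e e' m m'; lra.
Qed.

Lemma magn_lim_bound B : 0 < B -> `|magn_lim B| <= (1 + s) / 2.
Proof.
move=> B0; rewrite ler_norml; apply/andP; split.
  apply: (cvgr_to_ge (magn_limP B0)); apply: nearW => k.
  by have := magn_le (Lseq B k) B0; rewrite ler_norml => /andP[].
apply: (cvgr_to_le (magn_limP B0)); apply: nearW => k.
by have := magn_le (Lseq B k) B0; rewrite ler_norml => /andP[].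
Qed.

Lemma magn_lim_cvg : exists ms : R, magn_lim @ 0^'+ --> ms.
Proof.
eexists; apply: (@nondecreasing_at_right_cvgr _ magn_lim 0 (BLeft 1)).
- by rewrite bnd_simp.
- move=> x y; rewrite !in_itv /= => /andP[x0 _] /andP[y0 _] xy; exact: magn_lim_le.
- exists (- ((1 + s) / 2)) => _ [x xI <-]; move: xI; rewrite /= in_itv /= => /andP[x0 _].
  by have := magn_lim_bound x0; rewrite ler_norml => /andP[].
Qed.

(** The bound by [magn n B] holds in every box, where [magn n B] may fail to converge. Concavity
    replaces it by the energy difference quotient between [B] and [B'], which converges to a number
    at most [magn_lim B']. *)
Lemma spont_mag_le (w : forall n, op R d q n -> C) B' : 0 < B' ->
  is_ground_state S1 S2 S3 w -> spont_mag S3 w <= magn_lim B'.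
Proof.
(* Any field strictly between 0 and [B'] would serve. *)
move=> B'0 wG; pose B := B' / 2; have B0 : 0 < B by rewrite divr_gt0.
have BB' : 0 < B' - B by rewrite /B; lra.
apply: (@limn_sup_le _ _ _ ((1 + s) / 2)) => [n|eps eps0].
  apply: norm_div_vol.
  exact: (rstate_stag_le herm casimir (state_rstate wG.1 n)).
apply/near_inftyS.
pose f n := (B' - B)^-1 * (energy n.+1 B - energy n.+1 B') +
   2 * (d.*2%:R * s) / B * ((vol d n.+2 - vol d n)%N%:R / (vol d n.+1)%:R).
have shift B1 : 0 < B1 -> (fun n => energy n.+1 B1) @ \oo --> energy_lim B1.
  by move=> B10; have : [sequence energy n.+1 B1]_n @ \oo --> energy_lim B1 by
    rewrite (cvg_shiftS (energy^~ B1)); exact: energy_limP.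
have fP : f @ \oo --> (B' - B)^-1 * (energy_lim B - energy_lim B') + 2 * (d.*2%:R * s) / B * 0.
  apply: cvgD; first by apply: cvgM (cvgB (shift B B0) (shift B' B'0)); exact: cvg_cst.
  by apply: cvgM (@vol_ratio R d); exact: cvg_cst.
have lim_le : (B' - B)^-1 * (energy_lim B - energy_lim B') + 2 * (d.*2%:R * s) / B * 0 < magn_lim B' + eps.
  rewrite mulr0 addr0; apply: (@le_lt_trans _ _ (magn_lim B')); last by rewrite ltrDl.
  rewrite mulrC (ler_pdivrMr _ _ BB'); have := energy_lim_concave B'0 B0.
  move: (energy_lim B) (energy_lim B') (magn_lim B') => e e' m'; lra.
have H := cvgr_lt _ fP _ lim_le; near=> n.
have fn : f n < magn_lim B' + eps by near: n; exact: H.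
apply: le_trans (ltW fn).
apply: le_trans (ground_state_magn n B0 wG) _; rewrite /f lerD2r.
rewrite mulrC (ler_pdivlMr _ _ BB'); exact: slope_le (energy_concave n.+1 B0 B'0).
Unshelve. all: by end_near. Qed.

End Thermodynamic.

End FiniteVolume.

(** * The limiting ground state *)

Section LocalBound.
Variables (R : realType) (d q n : nat).
Local Notation C := R[i].
Variable r : op R d q n -> R.
Hypothesis rP : rstate r.
Hypothesis r_adj : forall a, r (adjmx a) = r a.

(** Positivity of X^* X with X replaced by 1 + X and 1 - X; [r_adj] merges the two cross terms. *)
Lemma rstate_abs_le (X : op R d q n) : `|r X| <= (1 + r (adjmx X *m X)) / 2.
Proof.
have := rstate_ge0 rP (1%:M + X); have := rstate_ge0 rP (1%:M - X).
rewrite adjmxB adjmxD adjmx1 !mulmxDl !mulmxDr !mulNmx !mulmxN opprK !mul1mx mulmx1.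
rewrite !(rstateD rP) !(rstateN rP) !r_adj (rstate1 rP) ler_norml => ? ?.
by apply/andP; split; lra.
Qed.

Lemma delta_mulC (i j : 'I_(Defs.dim d q n)) (c : C) :
  adjmx (c *: delta_mx i j) *m (c *: delta_mx i j) =
  ((complex.Re (c^* * c))%:C)%C *: delta_mx j j.
Proof.
have -> : adjmx (c *: delta_mx i j) = c^* *: delta_mx j i.
  by rewrite adjmxZ; congr (_ *: _); apply/matrixP => k l; rewrite !mxE rmorph_nat andbC.
rewrite -scalemxAl -scalemxAr mul_delta_mx scalerA; congr (_ *: _).
by rewrite RRe_real// ger0_real// mulrC mul_conjC_ge0.
Qed.

Lemma rstate_delta (j : 'I_(Defs.dim d q n)) : 0 <= r (delta_mx j j) <= 1.
Proof.
have ge0 k : 0 <= r (delta_mx k k).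
  have := rstate_ge0 rP (1 *: delta_mx k k); rewrite delta_mulC conjC1 mulr1 /=.
  by rewrite (rstateZ rP) mul1r.
rewrite ge0 /= -(rstate1 rP) -[1%:M]diag_const_mx [diag_mx _]diag_mx_sum_delta.
rewrite (rstate_sum rP) (bigD1 j) //= mxE scale1r lerDl sumr_ge0// => k _.
by rewrite mxE scale1r.
Qed.

(** A crude bound valid for all states at once, obtained from [rstate_abs_le] on each multiple of a
    matrix unit; it only has to supply compactness. *)
Definition op_bound (a : op R d q n) : R :=
  \sum_i \sum_j (1 + complex.Re ((a i j)^* * a i j)) / 2.

Lemma rstate_op_bound a : `|r a| <= op_bound a.
Proof.
rewrite {1}[a]matrix_sum_delta (rstate_sum rP).
apply: le_trans (ler_norm_sum _ _ _) _; apply: ler_sum => i _.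
rewrite (rstate_sum rP).
apply: le_trans (ler_norm_sum _ _ _) _; apply: ler_sum => j _.
apply: le_trans (rstate_abs_le _) _; rewrite delta_mulC (rstateZ rP).
rewrite ler_pM2r ?invr_gt0// lerD2l.
have c0 : 0 <= complex.Re ((a i j)^* * a i j) by apply: Re_ge0; rewrite mulrC mul_conjC_ge0.
by have /andP[_] := rstate_delta j; exact: ler_piMr.
Qed.

End LocalBound.

Section ComplexLimit.
Variables (R : realType) (T : Type) (U : set_system T).
Hypothesis UU : UltraFilter U.
Local Notation C := R[i].

(** Convergence by components, so that compactness of real segments and the limit theorems for real
    functions apply. *)
Definition cvgU (z : T -> C) (l : C) : Prop :=
  (fun k => complex.Re (z k)) @ U --> complex.Re l /\
  (fun k => complex.Im (z k)) @ U --> complex.Im l.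

Lemma cvgU_unique z l l' : cvgU z l -> cvgU z l' -> l = l'.
Proof.
case: l l' => a b [a' b'] [/= h1 h2] [/= h1' h2'].
congr (_ +i* _)%C; first exact: (cvg_unique (@norm_hausdorff _ R) h1 h1').
exact: (cvg_unique (@norm_hausdorff _ R) h2 h2').
Qed.

Lemma cvgU_near z z' l : (\forall k \near U, z k = z' k) -> cvgU z l -> cvgU z' l.
Proof.
move=> zz' [h1 h2]; split.
  by apply: cvg_trans h1; apply: near_eq_cvg; apply: filterS zz' => k ->.
by apply: cvg_trans h2; apply: near_eq_cvg; apply: filterS zz' => k ->.
Qed.

Lemma cvgU_cst l : cvgU (fun=> l) l.
Proof. by split; exact: cvg_cst. Qed.

Lemma cvgUD z z' l l' : cvgU z l -> cvgU z' l' -> cvgU (fun k => z k + z' k) (l + l').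
Proof.
have rD (x y : C) : complex.Re (x + y) = complex.Re x + complex.Re y by case: x y => a b [].
have iD (x y : C) : complex.Im (x + y) = complex.Im x + complex.Im y by case: x y => a b [].
move=> [h1 h2] [h1' h2']; split; rewrite ?rD ?iD.
  by under eq_fun do rewrite rD; exact: cvgD.
by under eq_fun do rewrite iD; exact: cvgD.
Qed.

Lemma cvgUM z z' l l' : cvgU z l -> cvgU z' l' -> cvgU (fun k => z k * z' k) (l * l').
Proof.
have rM (x y : C) : complex.Re (x * y) =
  complex.Re x * complex.Re y - complex.Im x * complex.Im y by case: x y => a b [].
have iM (x y : C) : complex.Im (x * y) =
  complex.Re x * complex.Im y + complex.Im x * complex.Re y by case: x y => a b [].
move=> [h1 h2] [h1' h2']; split; rewrite ?rM ?iM.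
  by under eq_fun do rewrite rM; apply: cvgB; exact: cvgM.
by under eq_fun do rewrite iM; apply: cvgD; exact: cvgM.
Qed.

Lemma cvgU_ge0 z l : (\forall k \near U, 0 <= z k) -> cvgU z l -> 0 <= l.
Proof.
case: l => a b z0 [/= h1 h2]; rewrite lecE /=; apply/andP; split.
  apply/eqP; apply: (cvg_unique (@norm_hausdorff _ R) h2).
  apply: cvg_trans (@cvg_cst _ (0 : R) _ U _); apply: near_eq_cvg.
  by apply: filterS z0 => k; rewrite lecE => /andP[/eqP].
apply: (cvgr_to_ge h1); apply: filterS z0 => k; exact: Re_ge0.
Qed.

Lemma cvgU_bounded z (M : R) :
  U [set k | `|complex.Re (z k)| <= M /\ `|complex.Im (z k)| <= M] ->
  exists l, cvgU z l.
Proof.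
move=> zM.
have [a ha] := @ultra_cvg R T U (fun k => complex.Re (z k)) M UU (filterS (fun _ => @proj1 _ _) zM).
have [b hb] := @ultra_cvg R T U (fun k => complex.Im (z k)) M UU (filterS (fun _ => @proj2 _ _) zM).
by exists (a +i* b)%C.
Qed.

End ComplexLimit.

Section Existence.
Variables (R : realType) (d q : nat).
Local Notation C := R[i].
Variables S1 S2 S3 : 'M[C]_q.
Hypothesis herm : adjmx S1 = S1 /\ adjmx S2 = S2 /\ adjmx S3 = S3.
Variables (L : nat -> nat) (B : nat -> R) (psi : forall k, vec R d q (L k)).
Hypothesis L_ge : forall k, (k <= L k)%N.
Hypothesis psi_ground : forall k, ground_vec (Hp d S1 S2 S3 (L k) (B k)) (psi k).
Variable U : set_system nat.
Hypothesis UU : UltraFilter U.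
Hypothesis Uoo : \oo `<=` U.
Hypothesis B_cvg0 : B @ U --> 0.

Let z n (a : op R d q n) k : C := expv (psi k) (embed_op (L k) a).

(** Embedding into a smaller box has no meaning; this concerns finitely many [k], which [U]
    ignores. *)
Lemma near_ge n : U [set k | (n <= L k)%N].
Proof.
apply: Uoo; exists n => // k /= nk; exact: leq_trans nk (L_ge k).
Qed.

Lemma local_cvg n (a : op R d q n) : exists l, cvgU U (z a) l.
Proof.
(* The second summand controls the imaginary part, which is the real part of the expectation of -i
   a. *)
apply: (@cvgU_bounded _ _ _ _ _ (op_bound a + op_bound ((- 'i%C) *: a))).
have B0 (a' : op R d q n) : 0 <= op_bound a'.
  apply: sumr_ge0 => i _; apply: sumr_ge0 => j _; rewrite divr_ge0// addr_ge0//.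
  by apply: Re_ge0; rewrite mulrC mul_conjC_ge0.
apply: filterS (near_ge n) => k nk.
have [v1 _] := psi_ground k.
have bnd (a' : op R d q n) : `|complex.Re (z a' k)| <= op_bound a'.
  apply: (@rstate_op_bound _ _ _ _ (fun a => complex.Re (z a k))).
    exact: (rstate_embed nk (rstate_expv v1)).
  by move=> b; rewrite /z embed_adj expv_adj; case: (expv _ _).
split; first by apply: le_trans (bnd a) _; rewrite lerDl.
have -> : complex.Im (z a k) = complex.Re (z ((- 'i%C) *: a) k).
  rewrite /z embedZ expvZ; case: (expv _ _) => x y.
  by rewrite /= oppr0 mul0r sub0r mulN1r opprK.
by apply: le_trans (bnd _) _; rewrite lerDr.
Qed.

(** A single ultrafilter gives limits on all local operators at once, which makes a diagonal
    extraction unnecessary. *)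
Definition limit_state n (a : op R d q n) : C := sval (cid (local_cvg a)).

Lemma limit_stateP n (a : op R d q n) : cvgU U (z a) (limit_state a).
Proof. by rewrite /limit_state; case: cid. Qed.

Lemma limit_stateE n (a : op R d q n) l : cvgU U (z a) l -> limit_state a = l.
Proof. exact: (cvgU_unique UU (limit_stateP a)). Qed.

Lemma limit_is_state : is_state limit_state.
Proof.
split; [|split; [|split]].
- move=> n c a b; apply: limit_stateE.
  have := cvgUD UU (cvgUM UU (cvgU_cst UU c) (limit_stateP a)) (limit_stateP b).
  apply: (cvgU_near UU); apply: filterE => k.
  by rewrite /z embedP expv_linear.
- move=> n a; apply: (cvgU_ge0 UU _ (limit_stateP _)).
  apply: filterS (near_ge n) => k nk; rewrite /z (embedM _ _ nk) embed_adj.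
  exact: expv_ge0.
- move=> n; apply: limit_stateE; apply: (cvgU_near UU _ (cvgU_cst UU 1)).
  apply: filterS (near_ge n) => k nk; rewrite /z.
  have [v1 _] := psi_ground k.
  by rewrite (embed1 _ _ _ nk) expv1.
- move=> n a; apply: limit_stateE; apply: (cvgU_near UU _ (limit_stateP a)).
  apply: filterS (near_ge n.+1) => k nk.
  by rewrite /z (embed_comp a (leqnSn n) nk).
Qed.

Lemma limit_is_ground_state : is_ground_state S1 S2 S3 limit_state.
Proof.
split=> [|n a]; first exact: limit_is_state.
pose a1 := embed_op n.+1 a.
(* The sequence in question is constant from [n.+1] on, and [l] is its value. *)
pose l := limit_state (adjmx a1 *m comm_mx2 (H0 d S1 S2 S3 n.+1) a1).
exists l; split; last first.
  move=> e e0; exists n.+1 => k nk.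
  rewrite [X in `|X - _|](_ : _ = l); last first.
    exact: (comm_H0_state S1 S2 S3 limit_is_state a nk).
  by rewrite subrr normr0 ltcR.
have Bz : cvgU U (fun k => ((B k)%:C)%C) 0 by split => //=; exact: cvg_cst.
have c1 := limit_stateP (adjmx a1 *m comm_mx2 (H0 d S1 S2 S3 n.+1) a1).
have c2 := limit_stateP (adjmx a1 *m comm_mx2 (stag d S3 n.+1) a1).
(* The limit of the stability inequalities at the fields [B k]: the commutator with the staggered
   magnetization is a fixed local operator, so its term vanishes with the field. *)
have c3 := cvgUD UU c1 (cvgUM UU (cvgU_cst UU (-1)) (cvgUM UU Bz c2)).
rewrite mul0r mulr0 addr0 in c3; apply: (cvgU_ge0 UU _ c3).
apply: filterS (near_ge n.+1) => k nk; rewrite /z.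
have := ground_comm_ge0 (Hp_adj d herm _ _) (psi_ground k) (embed_op (L k) a).
rewrite /Hp comm_mx2B comm_mx2Z mulmxBr -scalemxAr expvB expvZ.
rewrite (comm_H0_local S1 S2 S3 a (ltnSn n) nk).
rewrite (comm_stag_local S3 a (leqnSn n) nk) -/a1.
rewrite -(embed_comp a (leqnSn n) nk) -/a1 -embed_adj -!(embedM _ _ nk).
by rewrite mulN1r.
Qed.

End Existence.

Theorem theorem2p1 (R : realType) (d twoS : nat) (S1 S2 S3 : 'M[R[i]]_(twoS.+1))
  (hd : (1 <= d)%N) (hS : (1 <= twoS)%N)
  (herm : adjmx S1 = S1 /\ adjmx S2 = S2 /\ adjmx S3 = S3)
  (comm : S1 * S2 - S2 * S1 = 'i%C *: S3 /\ S2 * S3 - S3 * S2 = 'i%C *: S1 /\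
          S3 * S1 - S1 * S3 = 'i%C *: S2)
  (casimir : S1 * S1 + S2 * S2 + S3 * S3 =
             ((twoS%:R / 2) * (twoS%:R / 2 + 1))%:M)
  (Phi0 : forall n : nat, R -> vec R d twoS.+1 n)
  (hPhi0 : forall n (B : R), 0 < B ->
     ground_vec (Hp d S1 S2 S3 n B) (Phi0 n B) /\ trans2_inv (Phi0 n B))
  (Lseq : R -> nat -> nat)
  (hLseq : forall B : R, 0 < B ->
     (forall k, (Lseq B k < Lseq B k.+1)%N) /\
     (forall n0 (a : op R d twoS.+1 n0), exists l,
        cvgC (fun k => expv (Phi0 (Lseq B k) B) (embed_op (Lseq B k) a)) l)) :
  exists m : R -> R,
    (forall B : R, 0 < B ->
       (fun k => complex.Re (expv (Phi0 (Lseq B k) B) (stag d S3 (Lseq B k)))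
                 / (vol d (Lseq B k))%:R) @ \oo --> m B) /\
    exists ms : R,
      m @ 0^'+ --> ms /\
      (exists w : forall n, op R d twoS.+1 n -> R[i], is_ground_state S1 S2 S3 w /\ spont_mag S3 w = ms) /\
      (forall w : forall n, op R d twoS.+1 n -> R[i], is_ground_state S1 S2 S3 w -> spont_mag S3 w <= ms).
Proof.
pose s : R := (twoS%:R / 2) * (twoS%:R / 2 + 1).
have cas : S1 *m S1 + S2 *m S2 + S3 *m S3 = ((s%:C)%C)%:M.
  have -> : (s%:C)%C = (twoS%:R / 2) * (twoS%:R / 2 + 1) :> R[i].
    have half : ((twoS%:R / 2 : R)%:C)%C = twoS%:R / 2 :> R[i].
      by rewrite rmorphM fmorphV !rmorph_nat.
    rewrite -half; apply/eqP.
    by rewrite eq_complex /= !addr0 !mulr0 !mul0r subr0 addr0 !eqxx.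
  exact: casimir.
exists (magn_lim S3 Phi0 Lseq); split; first by move=> B B0; exact: (magn_limP hPhi0 hLseq B0).
have [ms msP] := magn_lim_cvg herm cas hPhi0 hLseq.
exists ms; split=> //; split; last first.
  move=> w wG; apply: (cvgr_to_ge msP); near=> B.
  by apply: (spont_mag_le herm cas hPhi0 hLseq _ wG); near: B; exact: nbhs_right_gt.
pose B k : R := harmonic k.
have B0 k : 0 < B k by rewrite /B /harmonic /= invr_gt0.
(* Diagonal choice along [Lseq (B k)]: the box index is at least [k], and the finite-volume
   magnetization is close to its limit, with [B k] itself as the tolerance. *)
have /choice[L LP] k : exists Lk, (k <= Lk)%N /\
    `|magn_lim S3 Phi0 Lseq (B k) - magn S3 Phi0 Lk (B k)| <= B k.
  have [N _ NP] := cvgr_dist_le (fun j => magn S3 Phi0 (Lseq (B k) j) (B k)) _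
    (magn_limP hPhi0 hLseq (B0 k)) _ (B0 k).
  exists (Lseq (B k) (maxn k N)); split; last exact: NP (leq_maxr k N).
  exact: leq_trans (leq_maxl k N) (Lseq_ge hLseq (maxn k N) (B0 k)).
have B_cvg : B @ \oo --> 0 by exact: cvg_harmonic.
have magn_cvg_ms : (fun k => magn S3 Phi0 (L k) (B k)) @ \oo --> ms.
  have c1 : (fun k => magn_lim S3 Phi0 Lseq (B k)) @ \oo --> ms.
    by move/cvg_at_rightP : msP; apply.
  have c2 := cvgB c1 B_cvg; have c3 := cvgD c1 B_cvg.
  rewrite subr0 in c2; rewrite addr0 in c3.
  apply: (@squeeze_cvgr _ \oo _ R (fun k => magn_lim S3 Phi0 Lseq (B k) - B k)
    (fun k => magn_lim S3 Phi0 Lseq (B k) + B k) _ _ ms); [|exact: c2|exact: c3].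
  apply: nearW => k; have [_] := LP k; rewrite ler_distlC.
  by rewrite lerBlDr -lerBlDl andbC.
have [U [UU Uoo]] := ultraFilterLemma eventually_filter.
have L_ge k : (k <= L k)%N := (LP k).1.
have psiG k := (hPhi0 (L k) (B k) (B0 k)).1.
have BU : B @ U --> 0 by apply: cvg_trans B_cvg => A /= /Uoo.
pose w := limit_state L_ge psiG UU Uoo.
have wG : is_ground_state S1 S2 S3 w by exact: limit_is_ground_state.
exists w; split=> //.
(* The equality is exact in every box, by period two, so the upper limit is that of a constant
   sequence. *)
have wm n : complex.Re (w n (stag d S3 n)) / (vol d n)%:R = ms.
  have [cr _] := limit_stateP L_ge psiG UU Uoo (stag d S3 n).
  have mU : (fun k => magn S3 Phi0 (L k) (B k) * (vol d n)%:R) @ U --> ms * (vol d n)%:R.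
    apply: cvgM; last exact: cvg_cst.
    by apply: cvg_trans magn_cvg_ms => A /= /Uoo.
  have -> : complex.Re (w n (stag d S3 n)) = ms * (vol d n)%:R.
    apply: (cvg_unique (@norm_hausdorff _ R) cr); apply: cvg_trans mU.
    apply: near_eq_cvg; apply: filterS (near_ge L_ge Uoo n) => k nk.
    by rewrite (Phi0_stag_embed hPhi0 (B0 k) nk).
  rewrite mulfK//; exact: lt0r_neq0 (volR_gt0 R d n).
rewrite /spont_mag (_ : (fun n => _) = fun=> ms); last by apply/funext => n; exact: wm.
by have [_ ->] := cvg_limn_inf_sup (@cvg_cst _ (ms : R) _ \oo _).
Unshelve. all: by end_near. Qed.
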